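(* Let $F \hookrightarrow X \stackrel{f}{\to} B$ be a surface bundle over a surface with fiber $F$ and base $B$ both of genus greater than $0$, and let $G := \pi_1(X)$. Assume that the Albanese dimension of $X$ is $a(X) = 2$. Then $G$ algebraically fibers.
   Context: Surfaces are closed, connected and orientable; a surface bundle over a surface is a locally trivial fiber bundle whose fiber and base are surfaces. For such a bundle $F \hookrightarrow X \stackrel{f}{\to} B$ with base and fiber both of genus greater than $0$, write $G := \pi_1(X)$, $K := \pi_1(F)$, $\Gamma := \pi_1(B)$; the homotopy exact sequence gives a group extension $1 \to K \to G \stackrel{f}{\to} \Gamma \to 1$. The bundle has Albanese dimension one, $a(X)=1$, if $f^*\colon H^1(\Gamma;\mathbb{R}) \to H^1(G;\mathbb{R})$ is an isomorphism; otherwise it has Albanese dimension two, $a(X) = 2$. A finitely generated group $G$ algebraically fibers if there exists an epimorphism $\phi\colon G \to \mathbb{Z}$ with finitely generated kernel. *)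

(* Defs.v *)
From HB Require Import structures.
From mathcomp Require Import all_boot all_order all_algebra.
From mathcomp Require Import all_classical all_reals all_analysis.
From mathcomp Require Import homotopy ring lra.

Set Implicit Arguments.
Unset Strict Implicit.
Unset Printing Implicit Defensive.

Import Order.TTheory GRing.Theory Num.Theory.
Import numFieldNormedType.Exports.

Local Open Scope classical_set_scope.
Local Open Scope ring_scope.
Local Open Scope quotient_scope.

Definition unit_interval (R : realType) : Type :=
  set_type [set t : R | 0 <= t <= 1].

HB.instance Definition _ (R : realType) :=
  Topological.copy (unit_interval R) (set_type [set t : R | 0 <= t <= 1]).

Section UnitInterval.
Variable R : realType.
Local Notation I := (unit_interval R).

Definition ival (t : I) : R := set_val t.

Lemma ival_itv (t : I) : 0 <= ival t <= 1.
Proof. by case: t => t t01; have := set_mem t01. Qed.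

Lemma ival_inj : injective ival.
Proof. exact: val_inj. Qed.

Lemma ival_continuous : continuous ival.
Proof.
exact: (@initial_continuous (set_type [set t : R | 0 <= t <= 1]) R set_val).
Qed.

Definition clamp_val (t : R) : R := Num.max 0 (Num.min 1 t).

Lemma clamp_val_itv t : clamp_val t \in [set t : R | 0 <= t <= 1].
Proof.
by rewrite inE /= /clamp_val le_max lexx /= ge_max ler01 /= ge_min lexx.
Qed.

Definition clamp (t : R) : I := exist _ (clamp_val t) (clamp_val_itv t).

Lemma clampK (t : R) : 0 <= t <= 1 -> ival (clamp t) = t.
Proof.
move=> /andP[t0 t1]; rewrite /ival set_valE /= /clamp_val.
by rewrite (min_idPr t1) (max_idPr t0).
Qed.

Lemma ivalK : cancel ival clamp.
Proof. by move=> t; apply: ival_inj; rewrite clampK ?ival_itv. Qed.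

Lemma clamp_continuous : continuous clamp.
Proof.
move=> t; apply: continuous_comp_initial => {}t.
rewrite /comp set_valE /= /clamp_val.
apply: (@continuous_max R R (cst 0) (fun t => Num.min 1 t)).
  exact: cst_continuous.
apply: (@continuous_min R R (cst 1) id).
  exact: cst_continuous.
exact: cvg_id.
Qed.

Lemma clamp01 : clamp 0 != clamp 1.
Proof.
apply/eqP => /(congr1 ival); rewrite !clampK ?lexx ?ler01 //.
by move=> /esym/eqP; rewrite oner_eq0.
Qed.

HB.instance Definition _ := isBiPointed.Build I clamp01.

Lemma ival0 : ival zero = 0. Proof. by rewrite clampK // lexx ler01. Qed.
Lemma ival1 : ival one = 1. Proof. by rewrite clampK // lexx ler01. Qed.

End UnitInterval.

Section RealContinuity.
Variables (R : realType) (S : topologicalType).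
Implicit Types (u a b : S -> R).

Lemma continuous_ival (g : S -> unit_interval R) :
  continuous g -> continuous (fun s => ival (g s)).
Proof.
move=> cg s; apply: (@continuous_comp _ _ _ g (@ival R)); first exact: cg.
exact: ival_continuous.
Qed.

Lemma continuous_clamp u : continuous u -> continuous (fun s => clamp (u s)).
Proof.
move=> cu s; apply: (@continuous_comp _ _ _ u (@clamp R)); first exact: cu.
exact: clamp_continuous.
Qed.

Lemma continuous_affine u (c d : R) :
  continuous u -> continuous (fun s => c * u s + d).
Proof.
move=> cu s; apply: (@cvgD _ R _ _ _ (fun s => c * u s) (cst d)).
  by apply: (@cvgM _ _ _ _ (cst c) u); [exact: cvg_cst|exact: cu].
exact: cvg_cst.
Qed.

Lemma continuous_interp u a b : continuous u -> continuous a -> continuous b ->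
  continuous (fun s => (1 - u s) * a s + u s * b s).
Proof.
move=> cu ca cb s.
apply: (@cvgD _ R _ _ _ (fun s => (1 - u s) * a s) (fun s => u s * b s)).
  apply: (@cvgM _ _ _ _ (fun s => 1 - u s) a); last exact: ca.
  by apply: (@cvgB _ R _ _ _ (cst 1) u); [exact: cvg_cst|exact: cu].
by apply: (@cvgM _ _ _ _ u b); [exact: cu|exact: cb].
Qed.

Lemma continuous_minr a b : continuous a -> continuous b ->
  continuous (fun s => Num.min (a s) (b s)).
Proof. by move=> ca cb s; apply: continuous_min; [exact: ca|exact: cb]. Qed.

Lemma continuous_maxr a b : continuous a -> continuous b ->
  continuous (fun s => Num.max (a s) (b s)).
Proof. by move=> ca cb s; apply: continuous_max; [exact: ca|exact: cb]. Qed.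

Lemma continuous_paste (T : topologicalType) u (F G : S -> T) (c : R) :
  continuous u -> continuous F -> continuous G ->
  (forall s, u s = c -> F s = G s) ->
  continuous (fun s => if u s <= c then F s else G s).
Proof.
move=> cu cF cG FG; set f := fun s => _.
have E : [set s | u s <= c] `|` [set s | c <= u s] = setT.
  by rewrite -subTset => s _ /=; case: (leP (u s) c); [left|right; exact: ltW].
apply/continuous_subspace_setT; rewrite -E.
apply: withinU_continuous.
- apply: (@closed_comp _ _ u [set x | x <= c]) => [s _|]; first exact: cu.
  exact: closed_le.
- apply: (@closed_comp _ _ u [set x | c <= x]) => [s _|]; first exact: cu.
  exact: closed_ge.
- apply: (@subspace_eq_continuous _ _ _ F); last exact: continuous_subspaceT.
  by move=> s; rewrite inE /= => sc; rewrite /from_subspace /f sc.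
- apply: (@subspace_eq_continuous _ _ _ G); last exact: continuous_subspaceT.
  move=> s; rewrite inE /= => cs; rewrite /from_subspace /f; case: leP => // sc.
  by apply/esym/FG/eqP; rewrite eq_le sc cs.
Qed.

End RealContinuity.

Section Paths.
Variables (R : realType) (T : topologicalType).
Local Notation I := (unit_interval R).

Lemma path_continuous (x y : T) (p : {path I from x to y}) :
  continuous (p : I -> T).
Proof. exact: cts_fun. Qed.

Section PathOperations.
Variables (x y z : T) (p : {path I from x to y}) (q : {path I from y to z}).

Definition path_cat_fun (t : I) : T :=
  if ival t <= 2^-1 then p (clamp (2 * ival t)) else q (clamp (2 * ival t - 1)).

Lemma path_cat_continuous : continuous path_cat_fun.
Proof.
apply: continuous_paste.
- exact: ival_continuous.
- move=> t; apply: (@continuous_comp _ _ _ (fun t => clamp (2 * ival t)) p);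
    last exact: path_continuous.
  apply: continuous_clamp => {}t.
  have := @continuous_affine R _ (@ival R) 2 0 (@ival_continuous R) t.
  by under eq_fun do rewrite addr0.
- move=> t; apply: (@continuous_comp _ _ _ (fun t => clamp (2 * ival t - 1)) q);
    last exact: path_continuous.
  by apply: continuous_clamp; apply: continuous_affine; exact: ival_continuous.
- move=> t ->; rewrite mulfV ?pnatr_eq0 // subrr.
  by rewrite -[clamp 1]/(one : I) -[clamp 0]/(zero : I) path_one path_zero.
Qed.

Lemma path_cat0 : path_cat_fun zero = x.
Proof.
by rewrite /path_cat_fun ival0 invr_ge0 ler0n mulr0 -[clamp 0]/(zero : I) path_zero.
Qed.

Lemma path_cat1 : path_cat_fun one = z.
Proof.
rewrite /path_cat_fun ival1 ifF; last by apply/negbTE; rewrite -ltNge; lra.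
by rewrite mulr1 (_ : 2 - 1 = 1); [rewrite -[clamp 1]/(one : I) path_one|ring].
Qed.

Definition path_cat : {path I from x to z} :=
  mk_path path_cat_continuous path_cat0 path_cat1.

Definition path_rev_fun (t : I) : T := p (clamp (1 - ival t)).

Lemma rev_continuous : continuous (fun t : I => clamp (1 - ival t)).
Proof.
apply: continuous_clamp => t.
have := @continuous_affine R _ (@ival R) (-1) 1 (@ival_continuous R) t.
by under eq_fun do rewrite mulN1r addrC.
Qed.

Lemma path_rev_continuous : continuous path_rev_fun.
Proof.
move=> t; apply: (@continuous_comp _ _ _ (fun t => clamp (1 - ival t)) p);
  last exact: path_continuous.
exact: rev_continuous.
Qed.

Lemma path_rev0 : path_rev_fun zero = y.
Proof. by rewrite /path_rev_fun ival0 subr0 -[clamp 1]/(one : I) path_one. Qed.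

Lemma path_rev1 : path_rev_fun one = x.
Proof. by rewrite /path_rev_fun ival1 subrr -[clamp 0]/(zero : I) path_zero. Qed.

Definition path_rev : {path I from y to x} :=
  mk_path path_rev_continuous path_rev0 path_rev1.

End PathOperations.

Definition path_cst (x : T) : {path I from x to x} := cst x.

(* Homotopy relative to the endpoints. *)
Definition path_homotopic (x y : T) (p q : {path I from x to y}) : Prop :=
  exists H : I * I -> T, continuous H /\
    [/\ forall t, H (t, zero) = p t, forall t, H (t, one) = q t,
        forall s, H (zero, s) = x & forall s, H (one, s) = y].

End Paths.

Section HomotopyLaws.
Variables (R : realType) (T : topologicalType).
Local Notation I := (unit_interval R).
Implicit Types x y : T.

Lemma continuous_pair_fst (U : topologicalType) (g : I -> U) :
  continuous g -> continuous (fun z : I * I => g z.1).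
Proof.
move=> cg z; apply: (@continuous_comp _ _ _ (@fst I I) g); last exact: cg.
exact: cvg_fst.
Qed.

Lemma continuous_pair_snd (U : topologicalType) (g : I -> U) :
  continuous g -> continuous (fun z : I * I => g z.2).
Proof.
move=> cg z; apply: (@continuous_comp _ _ _ (@snd I I) g); last exact: cg.
exact: cvg_snd.
Qed.

Lemma idI_continuous : continuous (fun t : I => t).
Proof. by move=> t; exact: cvg_id. Qed.

Lemma continuous_comp2 (S U : topologicalType) (a b : S -> I) (H : I * I -> U) :
  continuous a -> continuous b -> continuous H ->
  continuous (fun s => H (a s, b s)).
Proof.
move=> ca cb cH s.
apply: (@continuous_comp _ _ _ (fun s => (a s, b s)) H); last exact: cH.
exact: (cvg_pair (ca s) (cb s)).
Qed.

Lemma clamp0E : clamp 0 = zero :> I. Proof. by []. Qed.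
Lemma clamp1E : clamp 1 = one :> I. Proof. by []. Qed.

Lemma homotopic_reparam x y (x' y' : T)
    (p : {path I from x' to y'}) (f g : I -> I) (P Q : {path I from x to y}) :
  continuous f -> continuous g -> f zero = g zero -> f one = g one ->
  P =1 p \o f -> Q =1 p \o g -> path_homotopic P Q.
Proof.
move=> cf cg fg0 fg1 Pf Qg.
pose h (z : I * I) :=
  (1 - ival z.2) * ival (f z.1) + ival z.2 * ival (g z.1).
exists (fun z => p (clamp (h z))); split; last split => /=.
- move=> z; apply: (@continuous_comp _ _ _ (fun z => clamp (h z)) p).
    apply: continuous_clamp; apply: continuous_interp.
    + exact/continuous_pair_snd/ival_continuous.
    + exact: (continuous_pair_fst (continuous_ival cf)).
    + exact: (continuous_pair_fst (continuous_ival cg)).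
  exact: path_continuous.
- by move=> t; rewrite /h /= ival0 subr0 mul1r mul0r addr0 ivalK Pf.
- by move=> t; rewrite /h /= ival1 subrr mul1r mul0r add0r ivalK Qg.
- move=> s; rewrite /h /= fg0 -mulrDl subrK mul1r ivalK -fg0.
  by have /= <- := Pf zero; rewrite path_zero.
- move=> s; rewrite /h /= fg1 -mulrDl subrK mul1r ivalK -fg1.
  by have /= <- := Pf one; rewrite path_one.
Qed.

Lemma homotopic_refl x y (p : {path I from x to y}) : path_homotopic p p.
Proof.
by apply: (@homotopic_reparam _ _ _ _ p id id) => //; exact: idI_continuous.
Qed.

Lemma homotopic_sym x y (p q : {path I from x to y}) :
  path_homotopic p q -> path_homotopic q p.
Proof.
move=> [H [cH [H0 H1 Hx Hy]]].
exists (fun z => H (z.1, clamp (1 - ival z.2))); split; last split => /=.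
- apply: continuous_comp2 => //; first exact: (continuous_pair_fst idI_continuous).
  exact/(@continuous_pair_snd _ (fun t => clamp (1 - ival t)))/rev_continuous.
- by move=> t; rewrite ival0 subr0 clamp1E.
- by move=> t; rewrite ival1 subrr clamp0E.
- by move=> s; rewrite Hx.
- by move=> s; rewrite Hy.
Qed.

Lemma double_continuous : continuous (fun t : I => clamp (2 * ival t)).
Proof.
apply: continuous_clamp => t.
have := @continuous_affine R _ (@ival R) 2 0 (@ival_continuous R) t.
by under eq_fun do rewrite addr0.
Qed.

Lemma double1_continuous : continuous (fun t : I => clamp (2 * ival t - 1)).
Proof. exact/continuous_clamp/continuous_affine/ival_continuous. Qed.

Lemma homotopic_trans x y (p q r : {path I from x to y}) :
  path_homotopic p q -> path_homotopic q r -> path_homotopic p r.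
Proof.
move=> [H [cH [H0 H1 Hx Hy]]] [K [cK [K0 K1 Kx Ky]]].
exists (fun z => if ival z.2 <= 2^-1 then H (z.1, clamp (2 * ival z.2))
                 else K (z.1, clamp (2 * ival z.2 - 1))); split;
  last split => /=.
- apply: continuous_paste.
  + exact/continuous_pair_snd/ival_continuous.
  + apply: continuous_comp2 => //; first exact: (continuous_pair_fst idI_continuous).
    exact/(@continuous_pair_snd _ _ double_continuous).
  + apply: continuous_comp2 => //; first exact: (continuous_pair_fst idI_continuous).
    exact/(@continuous_pair_snd _ _ double1_continuous).
  + move=> z ->; rewrite mulfV ?pnatr_eq0 // subrr.
    by rewrite clamp0E clamp1E H1 K0.
- by move=> t; rewrite ival0 invr_ge0 ler0n mulr0 clamp0E.
- move=> t; rewrite ival1 ifF; last by apply/negbTE; rewrite -ltNge; lra.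
  by rewrite mulr1 (_ : 2 - 1 = 1); [rewrite clamp1E|ring].
- by move=> s; rewrite Hx Kx if_same.
- by move=> s; rewrite Hy Ky if_same.
Qed.

Lemma homotopic_cat x y (z : T) (p p' : {path I from x to y})
    (q q' : {path I from y to z}) :
  path_homotopic p p' -> path_homotopic q q' ->
  path_homotopic (path_cat p q) (path_cat p' q').
Proof.
move=> [H [cH [H0 H1 Hx Hy]]] [K [cK [K0 K1 Kx Ky]]].
exists (fun z => if ival z.1 <= 2^-1 then H (clamp (2 * ival z.1), z.2)
                 else K (clamp (2 * ival z.1 - 1), z.2)); split;
  last split => /=.
- apply: continuous_paste.
  + exact/continuous_pair_fst/ival_continuous.
  + apply: continuous_comp2 => //; last exact: (continuous_pair_snd idI_continuous).
    exact/(@continuous_pair_fst _ _ double_continuous).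
  + apply: continuous_comp2 => //; last exact: (continuous_pair_snd idI_continuous).
    exact/(@continuous_pair_fst _ _ double1_continuous).
  + move=> s ->; rewrite mulfV ?pnatr_eq0 // subrr.
    by rewrite clamp0E clamp1E Hy Kx.
- by move=> t; rewrite H0 K0.
- by move=> t; rewrite H1 K1.
- by move=> s; rewrite ival0 invr_ge0 ler0n mulr0 clamp0E.
- move=> s; rewrite ival1 ifF; last by apply/negbTE; rewrite -ltNge; lra.
  by rewrite mulr1 (_ : 2 - 1 = 1); [rewrite clamp1E|ring].
Qed.

Lemma homotopic_rev x y (p q : {path I from x to y}) :
  path_homotopic p q -> path_homotopic (path_rev p) (path_rev q).
Proof.
move=> [H [cH [H0 H1 Hx Hy]]].
exists (fun z => H (clamp (1 - ival z.1), z.2)); split; last split => /=.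
- apply: continuous_comp2 => //; last exact: (continuous_pair_snd idI_continuous).
  exact/(@continuous_pair_fst _ (fun t => clamp (1 - ival t)))/rev_continuous.
- by move=> t; rewrite H0.
- by move=> t; rewrite H1.
- by move=> s; rewrite ival0 subr0 clamp1E.
- by move=> s; rewrite ival1 subrr clamp0E.
Qed.

Lemma homotopic_cst_cat x y (p : {path I from x to y}) :
  path_homotopic (path_cat (path_cst R x) p) p.
Proof.
apply: (@homotopic_reparam _ _ _ _ p
  (fun t => clamp (Num.max 0 (2 * ival t - 1))) id) => //; try exact: idI_continuous.
- apply/continuous_clamp/continuous_maxr; first exact: cst_continuous.
  exact/continuous_affine/ival_continuous.
- by rewrite ival0 mulr0 sub0r (max_idPl _) // lerN10.
- by rewrite ival1 (max_idPr _); [rewrite mulr1 (_ : 2 - 1 = 1) //; ring|lra].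
- move=> t; rewrite /= /path_cat_fun /mk_path /=.
  case: leP => h; last by rewrite (max_idPr _) //; lra.
  by rewrite (max_idPl _) ?clamp0E ?path_zero //; lra.
Qed.

Lemma homotopic_cat_cst x y (p : {path I from x to y}) :
  path_homotopic (path_cat p (path_cst R y)) p.
Proof.
apply: (@homotopic_reparam _ _ _ _ p
  (fun t => clamp (Num.min 1 (2 * ival t + 0))) id) => //; try exact: idI_continuous.
- apply/continuous_clamp/continuous_minr; first exact: cst_continuous.
  exact/continuous_affine/ival_continuous.
- by rewrite ival0 mulr0 addr0 (min_idPr _).
- by rewrite ival1 (min_idPl _) //; lra.
- move=> t; rewrite /= /path_cat_fun /mk_path /= addr0.
  case: leP => h; first by rewrite (min_idPr _) //; lra.
  by rewrite (min_idPl _) ?clamp1E ?path_one //; lra.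
Qed.

Lemma homotopic_cat_rev x y (p : {path I from x to y}) :
  path_homotopic (path_cat p (path_rev p)) (path_cst R x).
Proof.
apply: (@homotopic_reparam _ _ _ _ p
  (fun t => clamp (Num.min (2 * ival t + 0) (-2 * ival t + 2)))
  (fun=> zero)) => //.
- by apply/continuous_clamp/continuous_minr;
    exact/continuous_affine/ival_continuous.
- exact: cst_continuous.
- by rewrite ival0 !mulr0 !add0r (min_idPl _).
- by rewrite ival1 !mulr1 addNr (min_idPr _) //; lra.
- move=> t; rewrite /= /path_cat_fun /mk_path /= addr0.
  have /andP[t0 t1] := ival_itv t.
  case: leP => h; first by rewrite (min_idPl _) //; lra.
  rewrite (min_idPr _); last lra.
  rewrite /mk_path /path_rev_fun clampK; last by apply/andP; split; lra.
  by congr (p (clamp _)); ring.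
- by move=> t; rewrite /= path_zero.
Qed.

Lemma homotopic_rev_cat x y (p : {path I from x to y}) :
  path_homotopic (path_cat (path_rev p) p) (path_cst R y).
Proof.
apply: (@homotopic_reparam _ _ _ _ p
  (fun t => clamp (Num.max (-2 * ival t + 1) (2 * ival t - 1)))
  (fun=> one)) => //.
- by apply/continuous_clamp/continuous_maxr;
    exact/continuous_affine/ival_continuous.
- exact: cst_continuous.
- by rewrite ival0 !mulr0 !add0r (max_idPl _) //; lra.
- by rewrite ival1 !mulr1 (max_idPr _); [rewrite (_ : 2 - 1 = 1) //; ring|lra].
- move=> t; rewrite /= /path_cat_fun /mk_path /=.
  have /andP[t0 t1] := ival_itv t.
  case: leP => h; last by rewrite (max_idPr _) //; lra.
  rewrite (max_idPl _); last lra.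
  rewrite /mk_path /path_rev_fun clampK; last by apply/andP; split; lra.
  by congr (p (clamp _)); ring.
- by move=> t; rewrite /= path_one.
Qed.

Lemma homotopic_catA x y (z w : T) (p : {path I from x to y})
    (q : {path I from y to z}) (r : {path I from z to w}) :
  path_homotopic (path_cat p (path_cat q r)) (path_cat (path_cat p q) r).
Proof.
apply: homotopic_sym.
pose h (t : I) := Num.min (2 * ival t + 0)
  (Num.min (1 * ival t + 4^-1) (2^-1 * ival t + 2^-1)).
have hE t : h t = if ival t <= 4^-1 then 2 * ival t else
    if ival t <= 2^-1 then ival t + 4^-1 else 2^-1 * ival t + 2^-1.
  rewrite /h addr0 mul1r.
  case: (leP (ival t) 4^-1) => t4; last case: (leP (ival t) 2^-1) => t2.
  - by rewrite (min_idPl _) // le_min; apply/andP; split; lra.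
  - rewrite (min_idPr _); first by rewrite (min_idPl _) //; lra.
    by rewrite ge_min; apply/orP; left; lra.
  - rewrite (min_idPr _); first by rewrite (min_idPr _) //; lra.
    by rewrite ge_min; apply/orP; right; lra.
apply: (@homotopic_reparam _ _ _ _ (path_cat p (path_cat q r))
  (fun t => clamp (h t)) id) => //; try exact: idI_continuous.
- by apply/continuous_clamp/continuous_minr;
    [|apply/continuous_minr]; exact/continuous_affine/ival_continuous.
- by rewrite hE ival0 mulr0 ifT // invr_ge0 ler0n.
- rewrite hE ival1 ifF; last by apply/negbTE; rewrite -ltNge; lra.
  rewrite ifF; last by apply/negbTE; rewrite -ltNge; lra.
  by rewrite mulr1 (_ : 2^-1 + 2^-1 = 1) //; field.
- move=> t /=; rewrite /mk_path /path_cat_fun /= /mk_path /path_cat_fun /=.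
  have /andP[t0 t1] := ival_itv t.
  have h01 : 0 <= h t <= 1.
    rewrite hE; case: (leP (ival t) 4^-1) => ?;
      last case: (leP (ival t) 2^-1) => ?;
      by apply/andP; split; lra.
  rewrite (clampK h01) hE.
  case: (leP (ival t) 4^-1) => t4; last case: (leP (ival t) 2^-1) => t2.
  - have c1 : ival t <= 2^-1 by lra.
    have c2 : 0 <= 2 * ival t <= 1 by apply/andP; split; lra.
    have c3 : 2 * ival t <= 2^-1 by lra.
    by rewrite c1 (clampK c2) c3.
  - have c1 : 0 <= 2 * ival t <= 1 by apply/andP; split; lra.
    have c2 : (2 * ival t <= 2^-1) = false.
      by apply/negbTE; rewrite -ltNge; lra.
    have c3 : (ival t + 4^-1 <= 2^-1) = false.
      by apply/negbTE; rewrite -ltNge; lra.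
    have c4 : 0 <= 2 * (ival t + 4^-1) - 1 <= 1 by apply/andP; split; lra.
    have c5 : 2 * (ival t + 4^-1) - 1 <= 2^-1 by lra.
    rewrite (clampK c1) c2 c3 (clampK c4) c5.
    by congr (q (clamp _)); field.
  - have c1 : (2^-1 * ival t + 2^-1 <= 2^-1) = false.
      by apply/negbTE; rewrite -ltNge; lra.
    have c2 : 0 <= 2 * (2^-1 * ival t + 2^-1) - 1 <= 1 by apply/andP; split; lra.
    have c3 : (2 * (2^-1 * ival t + 2^-1) - 1 <= 2^-1) = false.
      by apply/negbTE; rewrite -ltNge; lra.
    rewrite c1 (clampK c2) c3.
    by congr (r (clamp _)); field.
Qed.

End HomotopyLaws.

Section FundamentalGroup.
Variables (R : realType) (T : topologicalType) (x : T).
Local Notation I := (unit_interval R).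
Local Notation loop := {path I from x to x in T}.

Definition homotopicb (p q : loop) : bool := `[< path_homotopic p q >].

Lemma homotopicb_refl : reflexive homotopicb.
Proof. by move=> p; apply/asboolP/homotopic_refl. Qed.

Lemma homotopicb_sym : symmetric homotopicb.
Proof. by move=> p q; apply/asboolP/asboolP; exact: homotopic_sym. Qed.

Lemma homotopicb_trans : transitive homotopicb.
Proof.
by move=> q p r /asboolP pq /asboolP qr; apply/asboolP/(homotopic_trans pq qr).
Qed.

Canonical homotopicb_equiv :=
  EquivRel homotopicb homotopicb_refl homotopicb_sym homotopicb_trans.

Definition pi1 : Type := {eq_quot homotopicb}.

HB.instance Definition _ := Choice.on pi1.
HB.instance Definition _ := EqQuotient.on pi1.

Definition loop_class (p : loop) : pi1 := \pi_pi1 p.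

Lemma loop_classP (p q : loop) : loop_class p = loop_class q <-> path_homotopic p q.
Proof.
by split=> [/eqmodP/asboolP //|pq]; apply/eqmodP/asboolP.
Qed.

Lemma loop_class_surj (a : pi1) : exists p : loop, a = loop_class p.
Proof. by exists (repr a); rewrite /loop_class reprK. Qed.

Definition pi1_one : pi1 := loop_class (path_cst R x).
Definition pi1_mul (a b : pi1) : pi1 := loop_class (path_cat (repr a) (repr b)).
Definition pi1_inv (a : pi1) : pi1 := loop_class (path_rev (repr a)).

Lemma repr_class (p : loop) : path_homotopic (repr (loop_class p)) p.
Proof. by apply/loop_classP; rewrite /loop_class reprK. Qed.

Lemma pi1_mulE (p q : loop) :
  pi1_mul (loop_class p) (loop_class q) = loop_class (path_cat p q).
Proof. by apply/loop_classP/homotopic_cat; exact: repr_class. Qed.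

Lemma pi1_invE (p : loop) : pi1_inv (loop_class p) = loop_class (path_rev p).
Proof. by apply/loop_classP/homotopic_rev; exact: repr_class. Qed.

Lemma pi1_mulA : associative pi1_mul.
Proof.
move=> a b c; have [p ->] := loop_class_surj a.
have [q ->] := loop_class_surj b; have [r ->] := loop_class_surj c.
by rewrite !pi1_mulE; apply/loop_classP/homotopic_catA.
Qed.

Lemma pi1_1mul : left_id pi1_one pi1_mul.
Proof.
move=> a; have [p ->] := loop_class_surj a.
by rewrite pi1_mulE; apply/loop_classP/homotopic_cst_cat.
Qed.

Lemma pi1_mul1 : right_id pi1_one pi1_mul.
Proof.
move=> a; have [p ->] := loop_class_surj a.
by rewrite pi1_mulE; apply/loop_classP/homotopic_cat_cst.
Qed.

Lemma pi1_Vmul : left_inverse pi1_one pi1_inv pi1_mul.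
Proof.
move=> a; have [p ->] := loop_class_surj a.
by rewrite pi1_invE pi1_mulE; apply/loop_classP/homotopic_rev_cat.
Qed.

Lemma pi1_mulV : right_inverse pi1_one pi1_inv pi1_mul.
Proof.
move=> a; have [p ->] := loop_class_surj a.
by rewrite pi1_invE pi1_mulE; apply/loop_classP/homotopic_cat_rev.
Qed.

HB.instance Definition _ :=
  isGroup.Build pi1 pi1_mulA pi1_1mul pi1_mul1 pi1_Vmul pi1_mulV.

Lemma loop_class_cat (p q : loop) :
  (loop_class p * loop_class q)%g = loop_class (path_cat p q).
Proof. exact: pi1_mulE. Qed.

End FundamentalGroup.

Section InducedMap.
Variables (R : realType) (X Y : topologicalType) (f : continuousType X Y) (x : X).
Local Notation I := (unit_interval R).

Definition pi1_map (a : pi1 R x) : pi1 R (f x) :=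
  loop_class (f \o repr a : {path I from f x to f x in Y}).

Lemma pi1_mapE (p : {path I from x to x in X}) :
  pi1_map (loop_class p) = loop_class (f \o p : {path I from f x to f x in Y}).
Proof.
apply/loop_classP; have [H [cH [H0 H1 Hx Hy]]] := repr_class p.
exists (f \o H); split.
  by move=> z; apply: continuous_comp; [exact: cH|exact: cts_fun].
by split=> t /=; rewrite ?H0 ?H1 ?Hx ?Hy.
Qed.

Lemma pi1_map_mul : {morph pi1_map : a b / (a * b)%g}.
Proof.
move=> a b; have [p ->] := loop_class_surj a; have [q ->] := loop_class_surj b.
rewrite loop_class_cat !pi1_mapE loop_class_cat; congr loop_class.
apply/path_eqP => t /=; rewrite /mk_path /path_cat_fun /=.
by case: ifP.
Qed.

HB.instance Definition _ := isMultiplicative.Build _ _ pi1_map pi1_map_mul.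

End InducedMap.

Section FirstCohomology.
Variables (R : realType) (G : groupType).

(* For trivial coefficients, 1-coboundaries vanish and 1-cocycles are the
   homomorphisms from G to the additive group of R. *)
Definition is_cocycle : {pred G -> R^o} :=
  fun phi => `[< {morph phi : a b / (a * b)%g >-> a + b} >].

Lemma is_cocycle_submod : submod_closed is_cocycle.
Proof.
split; first by apply/asboolP => a b; rewrite /= addr0.
move=> c phi psi /asboolP hphi /asboolP hpsi; apply/asboolP => a b.
by rewrite !fctE hphi hpsi scalerDr addrACA.
Qed.

HB.instance Definition _ := GRing.isSubmodClosed.Build R (G -> R^o) is_cocycle
  is_cocycle_submod.

Record H1 := MkH1 { H1_fun :> G -> R^o; _ : H1_fun \in is_cocycle }.

HB.instance Definition _ := [isSub for H1_fun].
HB.instance Definition _ := [Choice of H1 by <:].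
HB.instance Definition _ := [SubChoice_isSubLmodule of H1 by <:].

End FirstCohomology.

Section Pullback.
Variables (R : realType) (G K : groupType) (u : {multiplicative G -> K}).

Lemma pullback_cocycle (phi : H1 R K) : (phi \o u : G -> R^o) \in @is_cocycle R G.
Proof.
case: phi => phi /= /asboolP hphi; apply/asboolP => a b /=.
by rewrite gmulfM hphi.
Qed.

Definition H1_pullback (phi : H1 R K) : H1 R G := MkH1 (pullback_cocycle phi).

Lemma H1_pullback_linear : linear H1_pullback.
Proof. by move=> c phi psi; apply/val_inj. Qed.

HB.instance Definition _ :=
  GRing.isLinear.Build R (H1 R K) (H1 R G) _ H1_pullback H1_pullback_linear.

End Pullback.

Section FinitenessProperties.
Variable G : groupType.

Definition is_subgroup (A : set G) : Prop :=
  A 1%g /\ forall a b, A a -> A b -> A (a * b^-1)%g.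

Definition finitely_generated (A : set G) : Prop :=
  exists2 S : set G, finite_set S & A = smallest is_subgroup S.

(* The target is the additive group of int; a group with this property is
   automatically finitely generated. *)
Definition algebraically_fibers : Prop :=
  exists phi : G -> int,
    [/\ {morph phi : a b / (a * b)%g >-> a + b},
        forall n, exists a, phi a = n
      & finitely_generated [set a | phi a = 0]].

End FinitenessProperties.

Definition homeomorphism_on (X Y : topologicalType) (A : set X) (B : set Y)
    (f : X -> Y) (g : Y -> X) : Prop :=
  [/\ {homo f : x / A x >-> B x}, {homo g : y / B y >-> A y},
      {in A, cancel f g} & {in B, cancel g f}] /\
  {within A, continuous f} /\ {within B, continuous g}.

Definition fiber_bundle (F X B : topologicalType) (f : X -> B) : Prop :=
  forall b, exists U : set B, [/\ open U, U b &
    exists (t : X -> F) (s : B * F -> X),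
      homeomorphism_on (f @^-1` U) (U `*` setT) (fun x => (f x, t x)) s].

Section Surfaces.
Variable R : realType.
Local Notation plane := (R * R)%type.

Definition polar (z : plane) (r t : R) : plane :=
  (z.1 + r * cos t, z.2 + r * sin t).

(* A map h that is a homeomorphism near z preserves orientation at z when the
   image under h of a small counterclockwise circle around z has winding number
   1 around h z; tau is a continuous choice of the argument of that image. *)
Definition orientation_preserving_at (h : plane -> plane) (z : plane) : Prop :=
  \forall r \near 0^'+, exists rho tau : R -> R,
    [/\ continuous tau, forall t, 0 < rho t,
        forall t, h (polar z r t) = polar (h z) (rho t) (tau t)
      & tau (2 * pi) = tau 0 + 2 * pi].

Variable S : topologicalType.

Record chart := MkChart {
  chart_dom : set S;
  chart_cod : set plane;
  chart_map : S -> plane;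
  chart_inv : plane -> S;
  chart_dom_open : open chart_dom;
  chart_cod_open : open chart_cod;
  chart_homeo : homeomorphism_on chart_dom chart_cod chart_map chart_inv }.

Definition locally_planar : Prop := forall x : S, exists c, chart_dom c x.

Definition orientable : Prop :=
  exists A : set chart,
    (forall x : S, exists2 c, A c & chart_dom c x) /\
    forall c c', A c -> A c' -> forall x : S, chart_dom c x -> chart_dom c' x ->
      orientation_preserving_at (chart_map c' \o chart_inv c) (chart_map c x).

(* Second countability follows from compactness and local planarity. *)
Definition surface : Prop :=
  [/\ [set: S] !=set0, compact [set: S], connected [set: S] &
   [/\ hausdorff_space S, locally_planar & orientable]].

(* 2 - 2 g is the Euler characteristic, that is, the first Betti number is 2 g;
   the first cohomology of a space is that of its fundamental group. *)
Definition has_genus (g : nat) : Prop :=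
  forall x : S, exists u : {linear H1 R (pi1 R x) -> 'rV[R]_(g.*2)}, bijective u.

End Surfaces.

(* H1_pullback is linear, so it is an isomorphism as soon as it is bijective. *)
Definition albanese_dim (R : realType) (X B : topologicalType)
    (f : continuousType X B) (x : X) : nat :=
  if `[< bijective (@H1_pullback R _ _ (@pi1_map R _ _ f x)) >] then 1%N else 2%N.

(* Main.v *)
Require Import Defs.
From HB Require Import structures.
From mathcomp Require Import all_boot all_order all_algebra.
From mathcomp Require Import all_classical all_reals all_analysis.
From mathcomp Require Import homotopy zify ring lra.

(** Let G and Gamma be the fundamental groups of X and B, let K be the kernel
    of the map f_* from G to Gamma.

    Topology provides three facts: f_* is onto, and the groups Gamma and K are
    finitely generated. Surjectivity is path lifting, followed by a correction
    inside a connected fiber. The group of a compact surface is finitely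
    generated because the surface has a finite cover by simply connected open
    sets whose intersecting pairs lie in simply connected sets
    [pi1_finitely_generated]. The group K is the image of the group of the
    fiber [pi1_kernel_fiber]: a homotopy in B from the projection of a loop p
    to a constant loop is cut into small squares lying in trivializing open
    sets, and an induction over these squares pushes p into the fiber
    [square_commutes_all, null_homotopic_in_fiber]. Hence G is finitely
    generated as well.

    Since the Albanese dimension is two, some real character of G is nonzero
    on K [pullback_bijective]; since B has positive genus, some nonzero real
    character of G vanishes on K. The coordinates of the values of a real
    character over the rational numbers turn it into an integral one
    [integral_character]. This gives characters psi and alpha of G with values
    in the integers such that psi is nonzero on K and alpha is nonzero but
    vanishes on K.

    It remains to see that chi = psi + m alpha has a finitely generated kernel
    when m is large [fibers_of_two_characters]. Choose t in K on which psi takes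
    its least positive value d on K, and finitely many elements x of K in the
    kernel of psi that generate K together with t. The kernel of chi in K is
    generated by the conjugates t^i x t^-i, for all integers i. Choose g with
    alpha (g) < 0, and s = t^M g in the kernel of chi; for large m the
    exponent M is large. Conjugation by g changes the generators of K into
    words of a bounded length, which does not depend on m, and conjugation by
    t^M shifts all exponents by M. When M exceeds the bound on these words,
    conjugation by s or by its inverse brings each t^i x t^-i with large |i|
    into the subgroup generated by those with smaller |i|. So finitely many of
    these conjugates generate, together with s, a group that contains the
    kernel of chi in K, and the rest of the kernel of chi is finitely generated
    over it [kernel_finitely_generated]. *)

Set Implicit Arguments.
Unset Strict Implicit.
Unset Printing Implicit Defensive.

Import Order.TTheory GRing.Theory Num.Theory.
Import numFieldNormedType.Exports.

Local Open Scope classical_set_scope.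
Local Open Scope ring_scope.

(** * Subgroups, integral powers and characters *)

Section GeneratedSubgroups.
Variable G : groupType.
Implicit Types (A S : set G) (a b g x : G).

Lemma subgroup1 A : is_subgroup A -> A 1%g.
Proof. by case. Qed.

Lemma subgroupV A a : is_subgroup A -> A a -> A (a^-1)%g.
Proof. by move=> [A1 AF] Aa; rewrite -[(a^-1)%g]mul1g; exact: AF. Qed.

Lemma subgroupM A a b : is_subgroup A -> A a -> A b -> A (a * b)%g.
Proof.
by move=> sA Aa Ab; rewrite -[b]invgK; apply: sA.2 => //; exact: subgroupV.
Qed.

Definition generated S : set G := smallest (@is_subgroup G) S.

Lemma generated_subgroup S : is_subgroup (generated S).
Proof.
split=> [A [sA _]|a b Sa Sb A [sA SA]]; first exact: subgroup1.
by apply: sA.2; [apply: Sa|apply: Sb].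
Qed.

Lemma sub_generated S : S `<=` generated S.
Proof. exact: sub_gen_smallest. Qed.

Lemma generated_sub A S : is_subgroup A -> S `<=` A -> generated S `<=` A.
Proof. exact: smallest_sub. Qed.

Lemma subset_generated S S' : S `<=` S' -> generated S `<=` generated S'.
Proof.
move=> SS'; apply: generated_sub; first exact: generated_subgroup.
exact: (subset_trans SS' (@sub_generated _)).
Qed.

End GeneratedSubgroups.

Section IntegerPowers.
Variable G : groupType.
Implicit Types (g h t : G) (i j : int).

Definition zpow g i : G :=
  match i with Posz n => (g ^+ n)%g | Negz n => (g ^- n.+1)%g end.

Lemma zpow0 g : zpow g 0 = 1%g. Proof. by []. Qed.

Lemma zpowS g i : zpow g (i + 1) = (zpow g i * g)%g.
Proof.
case: i => [n|n]; first by rewrite -PoszD addn1 /= expgSr.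
have -> : Negz n + 1 = - (n%:Z) by lia.
case: n => [|n]; first by rewrite oppr0 /= expg1 mulVg.
by rewrite -NegzE /= [(g ^+ n.+2)%g]expgS invgM mulgVK.
Qed.

Lemma zpowP g i : zpow g (i - 1) = (zpow g i * g^-1)%g.
Proof. by rewrite -{2}[i](subrK 1) zpowS mulgK. Qed.

Lemma int_step_ind (P : int -> Prop) : P 0 ->
  (forall i, P i -> P (i + 1)) -> (forall i, P i -> P (i - 1)) -> forall i, P i.
Proof.
move=> P0 PS PP; case=> n; elim: n => [|n IH].
- exact: P0.
- by have := PS _ IH; have -> : Posz n + 1 = Posz n.+1 by lia.
- exact: PP _ P0.
- by have := PP _ IH; have -> : Negz n - 1 = Negz n.+1 by lia.
Qed.

Lemma zpowD g i j : zpow g (i + j) = (zpow g i * zpow g j)%g.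
Proof.
elim/int_step_ind: j => [|j IH|j IH]; first by rewrite addr0 mulg1.
- by rewrite addrA !zpowS IH mulgA.
- by rewrite addrA !zpowP IH mulgA.
Qed.

Lemma zpowN g i : zpow g (- i) = ((zpow g i)^-1)%g.
Proof. by apply/esym/mulg1_eq; rewrite -zpowD subrr. Qed.

Lemma zpow_conj g h i : zpow (g^-1 * h * g)%g i = (g^-1 * zpow h i * g)%g.
Proof.
elim/int_step_ind: i => [|i IH|i IH]; rewrite ?zpowS ?zpowP ?IH ?gnorm //.
Qed.

Lemma zpow_subgroup (A : set G) g i : is_subgroup A -> A g -> A (zpow g i).
Proof.
move=> sA Ag; elim/int_step_ind: i => [|i IH|i IH]; rewrite ?zpowS ?zpowP.
- exact: subgroup1.
- exact: subgroupM.
- by apply: subgroupM => //; exact: subgroupV.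
Qed.

End IntegerPowers.

Section Characters.
Variables (G : groupType) (V : zmodType) (chi : G -> V).
Hypothesis chiM : {morph chi : a b / (a * b)%g >-> a + b}.

Lemma character1 : chi 1%g = 0.
Proof. by apply: (addrI (chi 1%g)); rewrite -chiM mulg1 addr0. Qed.

Lemma characterV g : chi (g^-1)%g = - chi g.
Proof. by apply: (addrI (chi g)); rewrite -chiM mulgV character1 subrr. Qed.

Lemma character_zpow g i : chi (zpow g i) = chi g *~ i.
Proof.
elim/int_step_ind: i => [|i IH|i IH]; first by rewrite character1.
- by rewrite zpowS chiM IH mulrzDr.
- by rewrite zpowP chiM characterV IH mulrzBr.
Qed.

Lemma kernel_subgroup : is_subgroup [set a | chi a = 0].
Proof.
split=> [|a b /= a0 b0]; first exact: character1.
by rewrite chiM characterV a0 b0 subrr.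
Qed.

End Characters.

Section Windows.
Variables (G : groupType) (X : set G) (t : G).
Local Open Scope group_scope.

Definition translates (lo hi : int) : set G :=
  [set g | exists i x, [/\ (lo <= i <= hi)%R, X x
                         & g = zpow t i * x * (zpow t i)^-1]].

(** When K is generated by X and t, with X in the kernel of a character of K that
    is nonzero at t, this kernel is the union of the windows. *)
Definition window (lo hi : int) : set G := generated (translates lo hi).

Lemma window_subgroup lo hi : is_subgroup (window lo hi).
Proof. exact: generated_subgroup. Qed.

Lemma sub_window lo hi lo' hi' :
  (lo' <= lo)%R -> (hi <= hi')%R -> window lo hi `<=` window lo' hi'.
Proof.
move=> lo_le hi_le; apply: subset_generated => g [i [x [ilh Xx ->]]].
by exists i, x; split=> //; lia.
Qed.

Lemma translates_finite lo hi : finite_set X -> finite_set (translates lo hi).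
Proof.
move=> finX.
apply: (@sub_finite_set _ _ ((fun p : int * G =>
    zpow t p.1 * p.2 * (zpow t p.1)^-1) @`
  ((fun n : nat => (lo + n%:Z)%R) @` `I_(`|hi - lo|.+1)%N `*` X))).
  move=> g [i [x [ilh Xx ->]]]; exists (i, x) => //; split=> //=.
  by exists `|i - lo|%N => /=; lia.
apply: finite_image; apply: finite_setX => //.
by apply: finite_image; exact: finite_II.
Qed.

Lemma window_ind (A : set G) lo hi : is_subgroup A ->
  (forall i x, (lo <= i <= hi)%R -> X x -> A (zpow t i * x * (zpow t i)^-1)) ->
  window lo hi `<=` A.
Proof.
move=> sA gen; apply: generated_sub => // g [i [x [ilh Xx ->]]].
exact: gen.
Qed.

(** With i read as a height that t raises by one, a word in t and X that starts at
    height i and evaluates to w ends at height i + e; C bounds the heights that it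
    meets on either side of i. *)
Definition spreads (w : G) (e C : int) : Prop := forall i : int,
  window (i - C) (i + C) (zpow t i * w * (zpow t (i + e))^-1).

Lemma spreadsW w e C C' : (C <= C')%R -> spreads w e C -> spreads w e C'.
Proof. by move=> CC' sw i; apply: sub_window (sw i); lia. Qed.

(** The word for the second factor starts at height i + e. *)
Lemma spreadsM w w' e e' C C' : (0 <= C)%R -> (0 <= C')%R ->
  spreads w e C -> spreads w' e' C' ->
  spreads (w * w') (e + e') (C + C' + `|e|)%R.
Proof.
move=> C0 C'0 sw sw' i.
have -> : zpow t i * (w * w') * (zpow t (i + (e + e')))^-1 =
    (zpow t i * w * (zpow t (i + e))^-1) *
    (zpow t (i + e) * w' * (zpow t (i + e + e'))^-1).
  by rewrite addrA !gnorm.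
apply: (subgroupM (window_subgroup _ _)).
- by apply: sub_window (sw i); lia.
- by apply: sub_window (sw' (i + e)%R); lia.
Qed.

Lemma spreadsV w e C : (0 <= C)%R -> spreads w e C ->
  spreads w^-1 (- e) (C + `|e|)%R.
Proof.
move=> C0 sw i.
have -> : zpow t i * w^-1 * (zpow t (i - e))^-1 =
    (zpow t (i - e) * w * (zpow t (i - e + e))^-1)^-1.
  by rewrite subrK !gnorm.
apply: (subgroupV (window_subgroup _ _)).
by apply: sub_window (sw (i - e)%R); lia.
Qed.

Lemma spreads_generators : exists2 C, (0 <= C)%R & spreads t 1 C.
Proof.
exists 0%R => // i; rewrite zpowS mulgV.
exact: (subgroup1 (window_subgroup _ _)).
Qed.

(** Elements of K are words in t and X, and a word spreads at most by its length. *)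
Lemma spreads_generated (K : set G) w : K = generated (t |` X) -> K w ->
  exists e C, (0 <= C)%R /\ spreads w e C.
Proof.
move=> -> /(_ [set w | exists e C, (0 <= C)%R /\ spreads w e C]); apply; split.
  split.
    exists 0%R, 0%R; split=> // i; rewrite mulg1 addr0 mulgV.
    exact: (subgroup1 (window_subgroup _ _)).
  move=> a b [e [C [C0 sa]]] [e' [C' [C'0 sb]]].
  exists (e - e')%R, (C + (C' + `|e'|) + `|e|)%R; split; first lia.
  apply: spreadsM => //; first lia.
  exact: spreadsV.
move=> x [->|Xx]; first by have [C C0 sC] := spreads_generators; exists 1%R, C.
exists 0%R, 0%R; split=> // i; rewrite addr0; apply: sub_generated.
by exists i, x; split=> //; lia.
Qed.

(** A power of y is a walk from height i to height i + n in steps of height one,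
    and each step strays by at most C. *)
Lemma spreads_power y C i n : (0 <= C)%R -> spreads y 1 C ->
  window (Num.min i (i + n) - C) (Num.max i (i + n) + C)
    (zpow t i * zpow y n * (zpow t (i + n))^-1).
Proof.
move=> C0 sy.
have key (m : nat) j : window (j - C) (j + m%:Z + C)
    (zpow t j * zpow y m * (zpow t (j + m%:Z))^-1).
  elim: m => [|m IH].
    by rewrite addr0 zpow0 mulg1 mulgV; exact: (subgroup1 (window_subgroup _ _)).
  have -> : zpow t j * zpow y m.+1 * (zpow t (j + m.+1%:Z))^-1 =
     (zpow t j * zpow y m * (zpow t (j + m%:Z))^-1) *
     (zpow t (j + m%:Z) * y * (zpow t (j + m%:Z + 1))^-1).
    by rewrite -addn1 PoszD addrA zpowS !gnorm.
  apply: (subgroupM (window_subgroup _ _)).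
  - by apply: sub_window IH; lia.
  - by apply: sub_window (sy (j + m%:Z)%R); lia.
have [n0|n0] := leP 0%R n.
  have := key `|n|%N i; have -> : `|n|%N%:Z = n by lia.
  by apply: sub_window; lia.
have := key `|n|%N (i + n)%R.
have -> : (i + n + `|n|%N%:Z)%R = i by lia.
have -> : (`|n|%N%:Z)%R = (- n)%R by lia.
rewrite zpowN => /(subgroupV (window_subgroup _ _)).
rewrite !gnorm; apply: sub_window; lia.
Qed.

(** Walk along y^n, then along w, then back. *)
Lemma spreads_conj y w C i n : (0 <= C)%R -> spreads y 1 C -> spreads w 0 C ->
  window (Num.min i (i + n) - C) (Num.max i (i + n) + C)
    (zpow t i * (zpow y n * w * (zpow y n)^-1) * (zpow t i)^-1).
Proof.
move=> C0 sy sw.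
have -> : zpow t i * (zpow y n * w * (zpow y n)^-1) * (zpow t i)^-1 =
  (zpow t i * zpow y n * (zpow t (i + n))^-1) *
  (zpow t (i + n) * w * (zpow t (i + n + 0))^-1) *
  (zpow t i * zpow y n * (zpow t (i + n))^-1)^-1.
  by rewrite addr0 !gnorm.
have sW := window_subgroup (Num.min i (i + n) - C) (Num.max i (i + n) + C).
apply: (subgroupM sW).
  apply: (subgroupM sW); first exact: spreads_power.
  by apply: sub_window (sw (i + n)%R); lia.
by apply: (subgroupV sW); exact: spreads_power.
Qed.

End Windows.

(** * Kernels of integral characters *)

Section Kernels.
Variable G : groupType.

(** The values of chi on A form a subgroup of the integers, generated by its least
    positive element. *)
Lemma character_generator (A : set G) (chi : G -> int) :
  {morph chi : a b / (a * b)%g >-> a + b} -> is_subgroup A ->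
  (exists2 a, A a & chi a != 0) ->
  exists t, [/\ A t, 0 < chi t & forall a, A a -> exists k, chi a = k * chi t].
Proof.
move=> chiM sA [a0 Aa0 chia0].
pose P n := `[< exists2 a, A a & chi a = n.+1%:Z >].
have exP : exists n, P n.
  exists `|chi a0|.-1; apply/asboolP.
  have [a0pos|a0neg] := ltP 0 (chi a0); first by exists a0 => //; lia.
  exists (a0^-1)%g; first exact: subgroupV.
  by rewrite (characterV chiM); lia.
case: (ex_minnP exP) => n /asboolP[t At chit] nmin.
exists t; split=> // [|a Aa]; first by rewrite chit.
exists (chi a %/ chi t)%Z; rewrite [LHS](divz_eq (chi a) (chi t)).
have t0 : chi t != 0 by rewrite chit.
have := modz_ge0 (chi a) t0; have := ltz_mod (chi a) t0.
set r := (chi a %% chi t)%Z => r_lt r_ge.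
have [-> |r0] := eqVneq r 0; first by rewrite addr0.
have /nmin : P `|r|.-1.
  apply/asboolP; exists (a * zpow t (- (chi a %/ chi t)%Z))%g.
    by apply: subgroupM => //; exact: zpow_subgroup.
  rewrite chiM (character_zpow chiM) -mulrzr; rewrite /r /modz; lia.
lia.
Qed.

(** The kernel N of chi maps onto a subgroup of finite index of G / K, because chi
    is nonzero on K. The proof is that of Reidemeister and Schreier. Let chi (u)
    generate the values of chi, and let chi (t), for t in K, generate those on K.
    Then N is generated by conjugates of finitely many elements by the powers of u.
    Conjugation by t changes an element of N by a commutator in the intersection of
    K and N, and a power u^q differs from t by an element of N; so the powers with
    exponents between 0 and q suffice. *)
Lemma kernel_finitely_generated (K : set G) (chi : G -> int) (S0 : set G) :
  {morph chi : a b / (a * b)%g >-> a + b} ->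
  finitely_generated [set: G] -> is_subgroup K ->
  (forall k g, K k -> K (g * k * g^-1)%g) ->
  (exists2 k, K k & chi k != 0) ->
  finite_set S0 -> S0 `<=` [set a | chi a = 0] ->
  K `&` [set a | chi a = 0] `<=` generated S0 ->
  finitely_generated [set a | chi a = 0].
Proof.
move=> chiM [S finS genS] sK nK exK finS0 S0N KN.
have [t [Kt tpos _]] := character_generator chiM sK exK.
have [|u [_ upos udiv]] := character_generator chiM (generated_subgroup [set: G]).
  by case: exK => k Kk k0; exists k => //; exact: sub_generated.
pose k a := xget 0 [set k | chi a = k * chi u].
have kE a : chi a = k a * chi u.
  have [k0 k0E] := udiv a (sub_generated I).
  exact: (@xgetPex _ 0 [set k | chi a = k * chi u] (ex_intro _ k0 k0E)).
have kM a b : k (a * b)%g = k a + k b.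
  by apply: (@mulIf _ (chi u)); rewrite ?lt0r_neq0 // mulrDl -!kE chiM.
have k1 : k 1%g = 0 by exact: character1.
have kV a : k (a^-1)%g = - k a by exact: characterV.
pose q := k t; have qpos : 0 < q by have := kE t; rewrite -/q; nia.
pose c := (t^-1 * zpow u q)%g.
pose Z := (fun g => g * (zpow u (k g))^-1)%g @` S.
pose T := S0 `|` [set c] `|` translates Z u 0 q.
have ku : k u = 1.
  by apply: (@mulIf _ (chi u)); rewrite ?lt0r_neq0 // -kE mul1r.
have kpow i : k (zpow u i) = i.
  by rewrite (character_zpow kM) ku; lia.
have NE a : chi a = 0 <-> k a = 0.
  rewrite kE; split=> [/eqP|->]; rewrite ?mul0r //.
  by rewrite mulf_eq0 (gt_eqF upos) orbF => /eqP.
have TN : T `<=` [set a | chi a = 0].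
  move=> a [[/S0N //|-> /=]|[i [x [_ [g Sg <-] ->]]] /=]; apply/NE.
    by rewrite kM kV kpow /q; lia.
  by rewrite !(kM, kV) !kpow; lia.
exists T.
  rewrite /T !finite_setU; split; first by split=> //; exact: finite_set1.
  by apply: translates_finite; exact: finite_image.
rewrite -/(generated T); set H := generated T.
have sH : is_subgroup H := generated_subgroup T.
have HN a : H a -> k a = 0.
  by move=> /(generated_sub (kernel_subgroup chiM) TN) /NE.
(* From here on k a, the value of chi at a measured in units of chi u, stands
   for chi a. *)
have KH a : K a -> k a = 0 -> H a.
  move=> Ka /NE a0; apply: (subset_generated _ (KN a _)) => // x S0x.
  by left; left.
(* Conjugating by s changes h by a commutator, which lies in K and in the
   kernel, hence in H. *)
have conjK (h s : G) : H h -> K s -> H (s * h * s^-1)%g.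
  move=> Hh Ks; rewrite -[(s * h * s^-1)%g](mulgVK h); apply: (subgroupM sH) => //.
  apply: KH; last by rewrite !(kM, kV) (HN h Hh); lia.
  rewrite -!mulgA; apply: (subgroupM sK) => //; rewrite !mulgA.
  by apply: nK; exact: (subgroupV sK).
have Hc : H c by apply: sub_generated; left; right.
have uqE : zpow u q = (t * c)%g by rewrite /c mulVKg.
have conjq (h : G) n : H h -> H (zpow u (n * q) * h * (zpow u (n * q))^-1)%g.
  move=> Hh; elim/int_step_ind: n => [|n IH|n IH].
  - by rewrite mul0r zpow0 !gnorm.
  - rewrite mulrDl mul1r addrC zpowD uqE.
    set v := zpow u (n * q) in IH *.
    have -> : (t * c * v * h * (t * c * v)^-1 =
               t * (c * (v * h * v^-1) * c^-1) * t^-1)%g by rewrite !gnorm.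
    apply: conjK => //; apply: (subgroupM sH) => //; last exact: (subgroupV sH).
    exact: (subgroupM sH).
  - rewrite mulrBl mul1r addrC zpowD zpowN uqE.
    set v := zpow u (n * q) in IH *.
    have -> : ((t * c)^-1 * v * h * ((t * c)^-1 * v)^-1 =
               c^-1 * (t^-1 * (v * h * v^-1) * (t^-1)^-1) * c)%g.
      by rewrite !gnorm.
    apply: (subgroupM sH) => //; apply: (subgroupM sH) => //.
      exact: (subgroupV sH).
    by apply: conjK => //; exact: (subgroupV sK).
have HZ i z : Z z -> H (zpow u i * z * (zpow u i)^-1)%g.
  move=> Zz; rewrite (divz_eq i q) zpowD.
  have -> (a b : G) : (a * b * z * (a * b)^-1 = a * (b * z * b^-1) * a^-1)%g.
    by rewrite !gnorm.
  apply: conjq; apply: sub_generated; right; exists (i %% q)%Z, z; split=> //.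
  by rewrite modz_ge0 ?gt_eqF //=; apply/ltW/ltz_pmod.
(* The elements a for which all these products lie in H form a subgroup, and
   those of the kernel satisfy k a = 0: take i = 0. *)
have Hall a i : H (zpow u i * a * (zpow u (i + k a))^-1)%g.
  suff : [set: G] `<=`
      [set a | forall i, H (zpow u i * a * (zpow u (i + k a))^-1)%g].
    by apply.
  rewrite genS; apply: generated_sub.
    split=> [j|x y Hx Hy j] /=.
      by rewrite k1 addr0 mulg1 mulgV; exact: (subgroup1 sH).
    have -> : (zpow u j * (x * y^-1) * (zpow u (j + k (x * y^-1)))^-1 =
       (zpow u j * x * (zpow u (j + k x))^-1) *
       (zpow u (j + k x - k y) * y * (zpow u (j + k x - k y + k y))^-1)^-1)%g.
      by rewrite kM kV subrK addrA !gnorm.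
    by apply: sH.2; [exact: Hx|exact: Hy].
  move=> g Sg j /=; rewrite zpowD.
  have -> : (zpow u j * g * (zpow u j * zpow u (k g))^-1 =
     zpow u j * (g * (zpow u (k g))^-1) * (zpow u j)^-1)%g by rewrite !gnorm.
  by apply: HZ; exists g.
apply/seteqP; split=> [a /NE a0|a /HN /NE //].
by have := Hall a 0; rewrite a0 addr0 zpow0 !gnorm.
Qed.

End Kernels.

(** * Fibering from two characters *)

Section SpreadDegree.
Variables (G : groupType) (X : set G) (t : G) (psi : G -> int).
Hypothesis psiM : {morph psi : a b / (a * b)%g >-> a + b}.
Hypothesis psiX : forall x, X x -> psi x = 0.

Lemma window_kernel lo hi : window X t lo hi `<=` [set a | psi a = 0].
Proof.
apply: window_ind => [|i x _ Xx /=]; first exact: kernel_subgroup.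
by rewrite !psiM (characterV psiM) (psiX Xx); lia.
Qed.

(** Windows consist of elements on which psi vanishes, so that w has the same value
    as t^e. *)
Lemma spreads_degree w e C : spreads X t w e C -> psi w = e * psi t.
Proof.
move=> /(_ 0) /window_kernel /=.
rewrite expg0 add0r !psiM (characterV psiM) (character_zpow psiM) mulrzz.
by rewrite (character1 psiM) => /eqP; rewrite add0r subr_eq0 mulrC => /eqP.
Qed.

Lemma finite_spreads (K Z : set G) : 0 < psi t -> K = generated (t |` X) ->
  finite_set Z -> Z `<=` K ->
  exists2 C, 0 <= C & forall z e, Z z -> psi z = e * psi t -> spreads X t z e C.
Proof.
move=> psit KE /finite_seqP[s ->]; elim: s => [|z s IH] sK; first by exists 0.
have [|C C0 Cs] := IH; first by move=> x xs; apply: sK; rewrite /= inE xs orbT.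
have [|e [C' [C'0 sz]]] := @spreads_generated _ X t K z KE.
  by apply: sK; rewrite /= inE eqxx.
exists (C + C'); first lia.
move=> x f; rewrite /= inE => /orP[/eqP ->|xs] xf.
  have -> : f = e by have := spreads_degree sz; rewrite xf; nia.
  by apply: spreadsW sz; lia.
by apply: spreadsW (Cs _ _ xs xf); lia.
Qed.

End SpreadDegree.

Section Fibering.
Variable G : groupType.

(** Divided by the generator of its values, chi becomes onto and keeps its kernel. *)
Lemma fibers_of_kernel (chi : G -> int) :
  {morph chi : a b / (a * b)%g >-> a + b} -> (exists a, chi a != 0) ->
  finitely_generated [set a | chi a = 0] -> algebraically_fibers G.
Proof.
move=> chiM [a a0] fg.
have [||u [_ upos udiv]] := @character_generator G [set: G] chi chiM.
- by split.
- by exists a.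
have u0 : chi u != 0 by rewrite gt_eqF.
pose k a := xget 0 [set k | chi a = k * chi u].
have kE b : chi b = k b * chi u.
  have [i iE] := udiv b I.
  exact: (@xgetPex _ 0 [set k | chi b = k * chi u] (ex_intro _ i iE)).
have kM : {morph k : a b / (a * b)%g >-> a + b}.
  by move=> b c; apply: (mulIf u0); rewrite mulrDl -!kE chiM.
exists k; split=> // [n|].
  exists (zpow u n); rewrite (character_zpow kM).
  have -> : k u = 1 by apply: (mulIf u0); rewrite -kE mul1r.
  lia.
suff -> : [set b | k b = 0] = [set b | chi b = 0] by [].
apply/seteqP; split=> b /=; rewrite kE; first by move=> ->; rewrite mul0r.
by move=> /eqP; rewrite mulf_eq0 (negbTE u0) orbF => /eqP.
Qed.

(** The character that fibers is psi + m * alpha for a large m. The bound C on the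
    spread of the conjugates of t and X by g does not depend on m, whereas the
    exponent M for which t^M g lies in the kernel grows with m. *)
Theorem fibers_of_two_characters (K : set G) (psi alpha : G -> int) :
  finitely_generated [set: G] -> finitely_generated K ->
  (forall k g, K k -> K (g * k * g^-1)%g) ->
  {morph psi : a b / (a * b)%g >-> a + b} ->
  {morph alpha : a b / (a * b)%g >-> a + b} ->
  (exists2 k, K k & psi k != 0) -> (forall k, K k -> alpha k = 0) ->
  (exists g, alpha g != 0) -> algebraically_fibers G.
Proof.
move=> fgG [SK finSK KE] nK psiM alphaM exK alphaK [g0 g0_neq0].
have sK : is_subgroup K by rewrite KE; exact: generated_subgroup.
have [t [Kt tpos tdiv]] := character_generator psiM sK exK.
set d := psi t in tpos tdiv.
have SKK : SK `<=` K by rewrite KE; exact: sub_generated.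
pose k a := xget 0 [set k | psi a = k * d].
have kE a : K a -> psi a = k a * d.
  by move=> /tdiv[i iE]; exact: (@xgetPex _ 0 [set k | psi a = k * d] (ex_intro _ i iE)).
pose X := (fun a => a * (zpow t (k a))^-1)%g @` SK.
have finX : finite_set X by exact: finite_image.
have XK : X `<=` K.
  move=> _ [a Sa <-]; apply: (subgroupM sK); first exact: SKK.
  by apply: (subgroupV sK); exact: zpow_subgroup.
have psiX x : X x -> psi x = 0.
  move=> [a Sa <-]; rewrite psiM (characterV psiM) (character_zpow psiM).
  by rewrite (kE _ (SKK _ Sa)); lia.
have KtX : K = generated (t |` X).
  apply/seteqP; split.
    rewrite KE; apply: generated_sub => [|a Sa]; first exact: generated_subgroup.
    have sg := generated_subgroup (t |` X).
    rewrite -[a](mulgVK (zpow t (k a))) ; apply: (subgroupM sg).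
      by apply: sub_generated; right; exists a.
    by apply: (zpow_subgroup _ sg); apply: sub_generated; left.
  by apply: (generated_sub sK) => x [->|/XK].
(* The power makes alpha negative at g, and d divides psi g. *)
pose g := zpow g0 (- (alpha g0 * d)); pose p := - (psi g0 * alpha g0).
have psig : psi g = p * d by rewrite (character_zpow psiM) mulrzz; lia.
have alphag : alpha g = - (alpha g0 ^+ 2 * d).
  by rewrite (character_zpow alphaM) mulrzz; lia.
pose Z := (t |` X).
have finZ : finite_set Z by rewrite finite_setU; split.
have ZK : Z `<=` K by move=> x [->|/XK].
pose Z1 := (fun z => g^-1 * z * g)%g @` Z.
pose Z2 := (fun z => g * z * g^-1)%g @` Z.
have Z1K : Z1 `<=` K.
  by move=> _ [z /ZK Kz <-]; have := nK z (g^-1)%g Kz; rewrite invgK.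
have Z2K : Z2 `<=` K by move=> _ [z /ZK Kz <-]; apply: nK.
have [||C C0 spreadC] := @finite_spreads _ X t psi psiM psiX K (Z1 `|` Z2) tpos KtX.
- by rewrite finite_setU; split; apply: finite_image.
- by move=> z []; [move=> /Z1K|move=> /Z2K].
have psiJ z : psi (g^-1 * z * g)%g = psi z.
  by rewrite !psiM (characterV psiM); lia.
have psiJ' z : psi (g * z * g^-1)%g = psi z.
  by rewrite !psiM (characterV psiM); lia.
(* M is minus the value of chi at g, in units of d. *)
pose m := C + 1 + `|p|; pose M := m * alpha g0 ^+ 2 - p.
have MC : C + 1 <= M.
  have sq1 : 1 <= alpha g0 ^+ 2 by nia.
  have m0 : 0 <= m by rewrite /m; lia.
  have := ler_peMr m0 sq1; rewrite /M; move: (m * _) => mA; rewrite /m; lia.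
pose chi a := psi a + m * alpha a.
have chiM : {morph chi : a b / (a * b)%g >-> a + b}.
  by move=> a b; rewrite /chi psiM alphaM; ring.
have chiK a : K a -> chi a = psi a by move=> Ka; rewrite /chi alphaK // mulr0 addr0.
pose s := (zpow t M * g)%g.
have chis : chi s = 0.
  rewrite chiM (character_zpow chiM) chiK // /chi psig alphag /M mulrzz -/d; ring.
pose S0 := s |` translates X t (- (M + C)) (M + C).
pose H := generated S0.
have sH : is_subgroup H := generated_subgroup S0.
have Hs : H s by apply: sub_generated; left.
(* Windows larger than [-(M + C), M + C] are reached one step at a time. For
   the two new generators, s^-1 t^i x t^-i s with i = n + 1 stays between
   heights - C and i - M + C, and s t^i x t^-i s^-1 with i = - (n + 1) between
   i + M - C and M + C; both lie in the previous window because C < M. *)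
have windowH (n : nat) : window X t (- n%:Z) n%:Z `<=` H.
  have base (j : nat) : j%:Z <= M + C -> window X t (- j%:Z) j%:Z `<=` H.
    move=> jle; apply: subset_trans (@subset_generated _
      (translates X t (- (M + C)) (M + C)) S0 _).
      by apply: sub_window; lia.
    by move=> x; right.
  elim: n => [|n IH]; first by apply: base; lia.
  have [small|large] := leP n.+1%:Z (M + C); first exact: base.
  apply: window_ind => // i x ilh Xx.
  have [i_le|i_gt] := leP `|i| n%:Z.
    apply: IH; apply: sub_generated; exists i, x; split=> //; lia.
  have [i_pos|i_neg] := ltP 0 i.
    have [j iE] : exists j, i = M + j by exists (i - M); lia.
    have -> : (zpow t i * x * (zpow t i)^-1 =
      s * (zpow t 0 * (zpow (g^-1 * t * g) j * (g^-1 * x * g) *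
      (zpow (g^-1 * t * g) j)^-1) * (zpow t 0)^-1) * s^-1)%g.
      by rewrite iE /s zpow_conj zpowD zpow0 !gnorm.
    apply: (subgroupM sH); last exact: (subgroupV sH).
    apply: (subgroupM sH) => //; apply: IH.
    apply: sub_window (@spreads_conj _ X t _ _ C 0 j C0 _ _); try lia.
      apply: spreadC; first by left; exists t => //; left.
      by rewrite psiJ mul1r.
    apply: spreadC; first by left; exists x => //; right.
    by rewrite psiJ psiX // mul0r.
  have -> : (zpow t i * x * (zpow t i)^-1 =
      s^-1 * (zpow t M * (zpow (g * t * g^-1) i * (g * x * g^-1) *
      (zpow (g * t * g^-1) i)^-1) * (zpow t M)^-1) * s)%g.
    by have := zpow_conj (g^-1)%g t i; rewrite invgK => ->; rewrite /s !gnorm.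
  apply: (subgroupM sH) => //; apply: (subgroupM sH); first exact: (subgroupV sH).
  apply: IH.
  apply: sub_window (@spreads_conj _ X t _ _ C M i C0 _ _); try lia.
    apply: spreadC; first by right; exists t => //; left.
    by rewrite psiJ' mul1r.
  apply: spreadC; first by right; exists x => //; right.
  by rewrite psiJ' psiX // mul0r.
apply: (fibers_of_kernel chiM).
  by exists t; rewrite chiK // gt_eqF.
apply: (@kernel_finitely_generated G K chi S0) => //.
- by case: exK => a Ka a0; exists a; rewrite ?chiK.
- rewrite finite_setU; split; first exact: finite_set1.
  exact: translates_finite.
- move=> _ [->//|[i [x [_ Xx ->]]]] /=.
  rewrite !chiM (characterV chiM) (chiK _ (XK _ Xx)) psiX //; lia.
- move=> a [Ka /=]; rewrite chiK // => a0.
  have [e [C' [C'0 sa]]] := spreads_generated KtX Ka.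
  have e0 : e = 0 by have := spreads_degree psiM psiX sa; rewrite a0 -/d; nia.
  have := sa 0; rewrite e0 add0r zpow0 !gnorm => wa.
  apply: (windowH `|C'|%N); apply: sub_window wa; lia.
Qed.

End Fibering.

(** * Integral characters from real characters *)

Section IntegralCharacters.
Variable R : numFieldType.

(** The linear relations with rational coefficients between the v i form a subspace;
    U is a matrix of the largest rank among those whose rows are relations. *)
Lemma relation_matrix n (v : 'I_n -> R) : exists U : 'M[rat]_n,
  forall w : 'rV[rat]_n, (w <= U)%MS = (\sum_i ratr (w 0 i) * v i == 0).
Proof.
pose rel (w : 'rV[rat]_n) := \sum_i ratr (w 0 i) * v i.
have relD a w w' : rel (a *: w + w') = ratr a * rel w + rel w'.
  rewrite /rel mulr_sumr -big_split; apply: eq_bigr => i _ /=.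
  by rewrite !mxE rmorphD rmorphM /= mulrDl mulrA.
pose P r := `[< exists U : 'M[rat]_n,
   (forall w : 'rV_n, (w <= U)%MS -> rel w = 0) /\ \rank U = r >].
have exP : exists r, P r.
  exists 0%N; apply/asboolP; exists 0; split=> [w|]; last by rewrite mxrank0.
  by rewrite submx0 => /eqP ->; apply: big1 => i _; rewrite mxE rmorph0 mul0r.
have bound r : P r -> (r <= n)%N by move=> /asboolP[U [_ <-]]; exact: rank_leq_row.
case: (ex_maxnP exP bound) => _ /asboolP[U [relU <-]] Umax.
exists U => w; apply/idP/eqP => [/relU//|w0].
have sU : (U <= U + w)%MS by exact: addsmxSl.
rewrite (submx_trans (addsmxSr U w)) // -(mxrank_leqif_sup sU).
rewrite eqn_leq mxrankS //=; apply: Umax; apply/asboolP.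
exists (U + w)%MS; split=> // w' /sub_addsmxP[[a b] /= ->].
rewrite [b]mx11_scalar mul_scalar_mx addrC relD [rel w]w0 mulr0 add0r.
by apply: relU; exact: submxMl.
Qed.

(** A relation is annihilated by every column of the cokernel of the relation matrix,
    while r0, which is none, is not annihilated by some column j. Clearing
    denominators in this column gives m. *)
Lemma integral_functional n (v : 'I_n -> R) (r0 : 'I_n -> int) :
  \sum_i (r0 i)%:~R * v i != 0 ->
  exists m : 'I_n -> int, \sum_i r0 i * m i != 0 /\
    forall r : 'I_n -> int, \sum_i (r i)%:~R * v i = 0 -> \sum_i r i * m i = 0.
Proof.
have [U UP] := relation_matrix v.
pose row (r : 'I_n -> int) : 'rV[rat]_n := \row_i (r i)%:~R.
have rowP r : (row r <= U)%MS = (\sum_i (r i)%:~R * v i == 0).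
  by rewrite UP; congr (_ == 0); apply: eq_bigr => i _; rewrite mxE ratr_int.
rewrite -rowP submxE => /rV0Pn[j].
pose c i := cokermx U i j; pose D := \prod_i denq (c i).
pose m i := numq (c i) * \prod_(k | k != i) denq (c k).
have mE i : (m i)%:~R = D%:~R * c i.
  rewrite /D (bigD1 i) //= !intrM [_ * c i]mulrAC [_ * c i]mulrC -numqE.
  by [].
have rmE r : (\sum_i r i * m i)%:~R = D%:~R * (row r *m cokermx U) 0 j.
  rewrite rmorph_sum mxE mulr_sumr; apply: eq_bigr => i _ /=.
  by rewrite intrM mE mxE mulrCA.
have D0 : D%:~R != 0 :> rat.
  by rewrite intr_eq0; apply/prodf_neq0 => i _; exact: denq_neq0.
move=> r0j; exists m; split=> [|r r_rel].
  by rewrite -(intr_eq0 rat) rmE mulf_neq0.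
apply/eqP; rewrite -(intr_eq0 rat) rmE.
have : (row r <= U)%MS by rewrite rowP r_rel.
by rewrite submxE => /eqP ->; rewrite mxE mulr0.
Qed.

Variable G : groupType.

(** Let v list the values of phi at finitely many generators. Each phi g is an
    integral combination of v, by coefficients that are unique up to relations; a
    functional that annihilates the relations is thus well defined and additive on
    G. *)
Lemma integral_character (phi : G -> R) g0 :
  finitely_generated [set: G] -> {morph phi : a b / (a * b)%g >-> a + b} ->
  phi g0 != 0 ->
  exists lam : G -> int, [/\ {morph lam : a b / (a * b)%g >-> a + b},
    lam g0 != 0 & forall g, phi g = 0 -> lam g = 0].
Proof.
move=> [S /finite_seqP[s SE] genS] phiM phig0.
pose n := size s; pose v (i : 'I_n) := phi (nth g0 s i).
have coordP g : exists r : 'I_n -> int, phi g = \sum_i (r i)%:~R * v i.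
  suff : [set: G] `<=` [set g | exists r : 'I_n -> int,
    phi g = \sum_i (r i)%:~R * v i] by apply.
  rewrite genS; apply: smallest_sub.
    split=> [|a b [r ra] [r' rb]].
      exists (fun=> 0); rewrite (character1 phiM) big1 // => i _.
      by rewrite mul0r.
    exists (fun i => r i - r' i); rewrite phiM (characterV phiM) ra rb.
    by rewrite -sumrB; apply: eq_bigr => i _; rewrite intrB mulrBl.
  rewrite SE => h /= hs; have ilt : (index h s < n)%N by rewrite index_mem.
  exists (fun i => (i == Ordinal ilt)%:Z).
  rewrite (bigD1 (Ordinal ilt)) //= eqxx mul1r big1 ?addr0.
    by rewrite /v /= nth_index.
  by move=> i /negbTE ->; rewrite mul0r.
have [r rE] : exists r : G -> 'I_n -> int,
    forall g, phi g = \sum_i (r g i)%:~R * v i.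
  by exists (fun g => projT1 (cid (coordP g))) => g; case: cid.
move: phig0; rewrite rE => /integral_functional[m [m0 mrel]].
exists (fun g => \sum_i r g i * m i); split=> // [a b|g g0E].
  apply/eqP; rewrite -subr_eq0 -big_split -sumrB /=; apply/eqP.
  rewrite -[RHS](mrel (fun i => r (a * b)%g i - (r a i + r b i))).
    by apply: eq_bigr => i _; rewrite mulrBl mulrDl.
  under eq_bigr do rewrite intrB intrD mulrBl mulrDl.
  by rewrite sumrB big_split /= -!rE phiM subrr.
by apply: mrel; rewrite -rE.
Qed.

End IntegralCharacters.

(** * Subdivision of squares and paths *)

Section SquareInduction.
Variables (R : realType) (T : topologicalType).
Local Notation I := (unit_interval R).

Definition lower_half (t : I) : I := clamp (2^-1 * ival t + 0).
Definition upper_half (t : I) : I := clamp (2^-1 * ival t + 2^-1).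

Lemma lower_half_continuous : continuous lower_half.
Proof. exact/continuous_clamp/continuous_affine/ival_continuous. Qed.

Lemma upper_half_continuous : continuous upper_half.
Proof. exact/continuous_clamp/continuous_affine/ival_continuous. Qed.

Lemma ival_lower_half t : ival (lower_half t) = 2^-1 * ival t.
Proof.
have /andP[t0 t1] := ival_itv t.
by rewrite /lower_half addr0 clampK //; apply/andP; split; lra.
Qed.

Lemma ival_upper_half t : ival (upper_half t) = 2^-1 * ival t + 2^-1.
Proof.
have /andP[t0 t1] := ival_itv t.
by rewrite /upper_half clampK //; apply/andP; split; lra.
Qed.

(** Clamping only serves to make this total: boxes are used for rectangles inside
    the unit square. *)
Definition box (H : I * I -> T) (a b h k : R) (z : I * I) : T :=
  H (clamp (a + h * ival z.1), clamp (b + k * ival z.2)).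

Lemma box_continuous H a b h k : continuous H -> continuous (box H a b h k).
Proof.
move=> cH.
have aff (c d : R) : continuous (fun t : I => clamp (c + d * ival t)).
  apply: continuous_clamp; under eq_fun do rewrite addrC.
  exact/continuous_affine/ival_continuous.
apply: continuous_comp2 => //.
- exact: (continuous_pair_fst (aff a h)).
- exact: (continuous_pair_snd (aff b k)).
Qed.

Variable U : set (set T).
Hypothesis coverU : forall y : T, exists2 A, U A & nbhs y A.

(** A Lebesgue number for the cover pulled back to the unit square, obtained from
    compactness. *)
Lemma small_boxes (H : I * I -> T) : continuous H ->
  exists n, forall a b, 0 <= a <= 1 -> 0 <= b <= 1 ->
    exists2 A, U A & forall z, A (box H a b (2^-1 ^+ n) (2^-1 ^+ n) z).
Proof.
move=> cH.
pose K : set (R * R) := `[0, 1] `*` `[0, 1].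
have compK : compact K by apply: compact_setX; exact: segment_compact.
pose G (p : R * R) : T := H (clamp p.1, clamp p.2).
have cG : continuous G.
  move=> p; apply: (@continuous_comp _ _ _ (fun p => (clamp p.1, clamp p.2)) H);
    last exact: cH.
  have c1 : continuous (fun p : R * R => clamp p.1).
    by apply: continuous_clamp => q; exact: cvg_fst.
  have c2 : continuous (fun p : R * R => clamp p.2).
    by apply: continuous_clamp => q; exact: cvg_snd.
  exact: (cvg_pair (c1 p) (c2 p)).
pose P n (p : R * R) :=
  exists2 A, U A & forall z, A (box H p.1 p.2 (2^-1 ^+ n) (2^-1 ^+ n) z).
have near_P p : K p -> \forall p' \near p & n \near \oo, P n p'.
  move=> _; have [A UA Ap] := coverU (G p).
  have /nbhs_ballP[e /= e0 eA] := cG p _ Ap.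
  have e2 : 0 < e / 2 by rewrite divr_gt0.
  exists (ball p (e / 2), [set n | 2^-1 ^+ n < e / 2]).
    split; first exact: nbhsx_ballx.
    have := near_infty_natSinv_expn_lt (PosNum e2).
    by apply: filter_app; near=> n => /=; rewrite div1r exprVn.
  move=> [[a b] n] /= [[pa pb] he]; exists A => // z.
  apply: (eA (a + 2^-1 ^+ n * ival z.1, b + 2^-1 ^+ n * ival z.2)).
  have /andP[s0 s1] := ival_itv z.1; have /andP[t0 t1] := ival_itv z.2.
  have h0 : 0 < 2^-1 ^+ n :> R by rewrite exprn_gt0.
  move: (2^-1 ^+ n) h0 he => h h0 he.
  have close (x y t : R) : `|x - y| < e / 2 -> 0 <= t -> t <= 1 ->
      `|x - (y + h * t)| < e.
    move=> xy t_ge0 t_le1; rewrite opprD addrA (le_lt_trans (ler_normB _ _)) //.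
    rewrite [e]splitr ltrD // ger0_norm; last by rewrite mulr_ge0 // ltW.
    by rewrite (le_lt_trans _ he) // ler_piMr // ltW.
  by split; rewrite /ball /=; apply: close.
have := (compact_near_coveringP K).1 compK nat \oo P _ near_P.
move=> [n _ /(_ n (leqnn n)) nP]; exists n => a b a01 b01.
by apply: (nP (a, b)); split; rewrite /= in_itv.
Unshelve. all: by end_near.
Qed.

(** The counterpart for squares of the theorem of small simplices: by the previous
    lemma P holds for all boxes of side 2^-n, and four boxes of side h make one of
    side 2 h. *)
Lemma square_induction (P : (I * I -> T) -> Prop) :
  (forall H, continuous H -> (exists2 A, U A & forall z, A (H z)) -> P H) ->
  (forall H, continuous H -> P (fun z => H (lower_half z.1, z.2)) ->
     P (fun z => H (upper_half z.1, z.2)) -> P H) ->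
  (forall H, continuous H -> P (fun z => H (z.1, lower_half z.2)) ->
     P (fun z => H (z.1, upper_half z.2)) -> P H) ->
  forall H, continuous H -> P H.
Proof.
move=> Psmall Phor Pver H cH.
have [n small] := small_boxes cH.
pose S h := forall a b, 0 <= a -> a + h <= 1 -> 0 <= b -> b + h <= 1 ->
  P (box H a b h h).
have cbox a b h k : continuous (box H a b h k) by exact: box_continuous.
have halveE (a h k : R) t : 0 <= a -> 0 < h -> k = 2^-1 * h -> a + h <= 1 ->
    a + k * ival t = a + h * ival (lower_half t) /\
    a + k + k * ival t = a + h * ival (upper_half t).
  move=> a0 h0 -> ah; rewrite ival_lower_half ival_upper_half; split; ring.
have double h : 0 < h -> S (2^-1 * h) -> S h.
  move=> h0 Sh a b a0 ah b0 bh.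
  have fstE c k : ((fun z : I * I => box H a c h k (lower_half z.1, z.2)) =
      box H a c (2^-1 * h) k) /\
      ((fun z : I * I => box H a c h k (upper_half z.1, z.2)) =
      box H (a + 2^-1 * h) c (2^-1 * h) k).
    split; apply/funext => z; rewrite /box /=;
    by have [E1 E2] := halveE a h _ z.1 a0 h0 erefl ah; rewrite ?E1 ?E2.
  have sndE c k : ((fun z : I * I => box H c b k h (z.1, lower_half z.2)) =
      box H c b k (2^-1 * h)) /\
      ((fun z : I * I => box H c b k h (z.1, upper_half z.2)) =
      box H c (b + 2^-1 * h) k (2^-1 * h)).
    split; apply/funext => z; rewrite /box /=;
    by have [E1 E2] := halveE b h _ z.2 b0 h0 erefl bh; rewrite ?E1 ?E2.
  apply: Phor; rewrite ?(fstE _ _).1 ?(fstE _ _).2 //;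
    apply: Pver; rewrite ?(sndE _ _).1 ?(sndE _ _).2 //; apply: Sh; lra.
have Sk k : (k <= n)%N -> S (2^-1 ^+ (n - k)).
  elim: k => [_|k IH kn].
    rewrite subn0 => a b a0 ah b0 bh; apply: Psmall => //.
    have h0 : 0 < 2^-1 ^+ n :> R by rewrite exprn_gt0.
    by apply: small; apply/andP; split => //; lra.
  apply: double; first by rewrite exprn_gt0.
  by rewrite -exprS -subSn // subSS; apply: IH; exact: ltnW.
have -> : H = box H 0 0 1 1.
  by apply/funext => -[s t]; rewrite /box /= !add0r !mul1r !ivalK.
have := Sk n (leqnn n); rewrite subnn expr0.
by apply; rewrite ?add0r.
Qed.

End SquareInduction.

Section PathEnds.
Variables (R : realType) (T : topologicalType) (y z : T).
Variable p : {path (unit_interval R) from y to z}.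

Lemma path_start : p zero = y. Proof. exact: path_zero. Qed.
Lemma path_end : p one = z. Proof. exact: path_one. Qed.

End PathEnds.

Section PathInduction.
Variables (R : realType) (T : topologicalType).
Local Notation I := (unit_interval R).

Lemma path_lower_half (y z : T) (p : {path I from y to z}) m :
  p (clamp 2^-1) = m ->
  exists q : {path I from y to m}, forall t, q t = p (lower_half t).
Proof.
move=> pm.
have c : continuous (fun t => p (lower_half t)).
  move=> t; apply: (@continuous_comp _ _ _ (@lower_half R) p).
    exact: lower_half_continuous.
  exact: path_continuous.
have c0 : p (lower_half zero) = y.
  by rewrite /lower_half ival0 mulr0 addr0 clamp0E path_zero.
have c1 : p (lower_half one) = m.
  by rewrite /lower_half ival1 mulr1 addr0.
by exists (mk_path c c0 c1).
Qed.

Lemma path_upper_half (y z : T) (p : {path I from y to z}) m :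
  p (clamp 2^-1) = m ->
  exists q : {path I from m to z}, forall t, q t = p (upper_half t).
Proof.
move=> pm.
have c : continuous (fun t => p (upper_half t)).
  move=> t; apply: (@continuous_comp _ _ _ (@upper_half R) p).
    exact: upper_half_continuous.
  exact: path_continuous.
have c0 : p (upper_half zero) = m.
  by rewrite /upper_half ival0 mulr0 add0r.
have c1 : p (upper_half one) = z.
  rewrite /upper_half ival1 mulr1 (_ : 2^-1 + 2^-1 = 1) ?clamp1E ?path_one //.
  by field.
by exists (mk_path c c0 c1).
Qed.

Lemma path_cat_halves (y m z : T) (p : {path I from y to z})
    (q : {path I from y to m}) (r : {path I from m to z}) :
  (forall t, q t = p (lower_half t)) -> (forall t, r t = p (upper_half t)) ->
  p = path_cat q r.
Proof.
move=> qE rE; apply/path_eqP => t /=; rewrite /mk_path /path_cat_fun.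
have /andP[t0 t1] := ival_itv t.
case: leP => tle; rewrite ?qE ?rE; congr (p _); apply: ival_inj.
- rewrite ival_lower_half clampK; first by field.
  by apply/andP; split; lra.
- rewrite ival_upper_half clampK; first by field.
  by apply/andP; split; lra.
Qed.

Lemma split_path (y z : T) (p : {path I from y to z}) :
  exists m (q : {path I from y to m}) (r : {path I from m to z}),
  [/\ p = path_cat q r, forall t, q t = p (lower_half t)
    & forall t, r t = p (upper_half t)].
Proof.
exists (p (clamp 2^-1)).
have [q qE] := path_lower_half (erefl (p (clamp 2^-1))).
have [r rE] := path_upper_half (erefl (p (clamp 2^-1))).
by exists q, r; split=> //; exact: path_cat_halves.
Qed.

Variable U : set (set T).
Hypothesis coverU : forall y : T, exists2 A, U A & nbhs y A.

(** A path is seen as a square that does not depend on its second variable. *)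
Lemma path_induction (P : forall y z : T, {path I from y to z} -> Prop) :
  (forall y z (p : {path I from y to z}),
     (exists2 A, U A & forall t, A (p t)) -> P y z p) ->
  (forall y m z (p : {path I from y to m}) (q : {path I from m to z}),
     P y m p -> P m z q -> P y z (path_cat p q)) ->
  forall y z (p : {path I from y to z}), P y z p.
Proof.
move=> Psmall Pcat y z p.
pose Q (H : I * I -> T) := forall s y z (p : {path I from y to z}),
  (forall t, p t = H (t, s)) -> P y z p.
suff Qp : Q (fun z => p z.1) by exact: (Qp zero y z p (fun=> erefl)).
apply: (square_induction coverU).
- move=> H cH [A UA HA] s y' z' q qE; apply: Psmall; exists A => // t.
  by rewrite qE.
- move=> H cH Ql Qu s y' z' q qE.
  have [m [q1 [q2 [qcat q1E q2E]]]] := split_path q; rewrite qcat.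
  apply: Pcat; first by apply: (Ql s) => t; rewrite q1E qE.
  by apply: (Qu s) => t; rewrite q2E qE.
- move=> H cH Ql Qu s y' z' q qE.
  have /andP[s0 s1] := ival_itv s.
  have [sle|sgt] := leP (ival s) 2^-1.
    apply: (Ql (clamp (2 * ival s))) => t; rewrite qE /=; congr (H (_, _)).
    apply: ival_inj; rewrite ival_lower_half clampK; first by field.
    by apply/andP; split; lra.
  apply: (Qu (clamp (2 * ival s - 1))) => t; rewrite qE /=; congr (H (_, _)).
  apply: ival_inj; rewrite ival_upper_half clampK; first by field.
  by apply/andP; split; lra.
- by apply: continuous_pair_fst; exact: path_continuous.
Qed.

End PathInduction.

(** * Simply connected open sets *)

Section SimplySets.
Variables (R : realType) (T : topologicalType).
Local Notation I := (unit_interval R).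

Definition joined (A : set T) (y z : T) : Prop :=
  exists p : {path I from y to z}, forall t, A (p t).

(** Paths with common endpoints are compared, rather than loops contracted, and the
    homotopy has to stay in A: it will be lifted through a trivialization over A. *)
Definition simply_connected (A : set T) : Prop :=
  (forall y z, A y -> A z -> joined A y z) /\
  forall y z (p q : {path I from y to z}),
    (forall t, A (p t)) -> (forall t, A (q t)) ->
    exists H : I * I -> T, [/\ continuous H, forall z, A (H z) &
      [/\ forall t, H (t, zero) = p t, forall t, H (t, one) = q t,
        forall s, H (zero, s) = y & forall s, H (one, s) = z]].

Definition locally_simply_connected : Prop := forall (y : T) (W : set T), nbhs y W ->
  exists A : set T, [/\ open A, A y, A `<=` W & simply_connected A].

Lemma simply_connected_homotopic A y z (p q : {path I from y to z}) :
  simply_connected A -> (forall t, A (p t)) -> (forall t, A (q t)) ->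
  path_homotopic p q.
Proof.
by move=> [_ sA] Ap Aq; have [H [cH _ ?]] := sA _ _ p q Ap Aq; exists H.
Qed.

Lemma joined_refl A y : A y -> joined A y y.
Proof. by exists (path_cst R y). Qed.

Lemma joined_trans A y z w : joined A y z -> joined A z w -> joined A y w.
Proof.
move=> [p Ap] [q Aq]; exists (path_cat p q) => t.
by rewrite /= /mk_path /path_cat_fun; case: ifP.
Qed.

(** The set of the points that can be reached from y is open and closed. *)
Lemma connected_joined : locally_simply_connected -> connected [set: T] ->
  forall y z : T, joined setT y z.
Proof.
move=> simT conT y z.
pose B := [set w | joined setT y w].
have nbB w w' : joined setT y w ->
    (exists A, [/\ open A, A w, simply_connected A & A w']) -> joined setT y w'.
  move=> yw [A [_ Aw [jA _] Aw']]; apply: joined_trans yw _.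
  by have [p _] := jA _ _ Aw Aw'; exists p.
have oB : open B.
  rewrite openE => w Bw; have [A [oA Aw _ sA]] := simT w setT filterT.
  apply: (@filterS _ _ _ A); last exact: open_nbhs_nbhs.
  by move=> w' Aw'; apply: (nbB w) => //; exists A.
have cB : closed B.
  rewrite -[B]setCK; apply: open_closedC; rewrite openE => w /= Bw.
  have [A [oA Aw _ sA]] := simT w setT filterT.
  apply: (@filterS _ _ _ A); last exact: open_nbhs_nbhs.
  move=> w' Aw' Bw'; apply: Bw; apply: (nbB w') => //.
  by exists A.
suff BT : B = setT by have : B z by rewrite BT.
by apply: conT; [exists y; exact: joined_refl|exists B; rewrite ?setTI..].
Qed.

End SimplySets.

Lemma continuous_comp_on (X Y Z : topologicalType) (A : set Y) (f : Y -> Z)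
    (g : X -> Y) : open A -> {within A, continuous f} -> continuous g ->
  (forall x, A (g x)) -> continuous (f \o g).
Proof.
move=> oA; rewrite continuous_open_subspace // => cf cg Ag x.
by apply: continuous_comp; [exact: cg|apply: cf; rewrite inE; exact: Ag].
Qed.

Section LocallyPlanar.
Variables (R : realType) (S : topologicalType).
Local Notation I := (unit_interval R).
Local Notation plane := (R * R)%type.

Definition segment (z w : plane) (t : R) : plane :=
  ((1 - t) * z.1 + t * w.1, (1 - t) * z.2 + t * w.2).

Lemma ball_segment (c : plane) e z w t : ball c e z -> ball c e w ->
  0 <= t <= 1 -> ball c e (segment z w t).
Proof.
have key (a b d : R) : `|a - b| < e -> `|a - d| < e -> 0 <= t <= 1 ->
    `|a - ((1 - t) * b + t * d)| < e.
  move=> ab ad /andP[t0 t1].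
  have -> : a - ((1 - t) * b + t * d) = (1 - t) * (a - b) + t * (a - d) by ring.
  rewrite (le_lt_trans (ler_normD _ _)) // !normrM.
  rewrite (ger0_norm t0) ger0_norm ?subr_ge0 //.
  have Me : Num.max `|a - b| `|a - d| < e by rewrite gt_max ab ad.
  rewrite (le_lt_trans _ Me) //.
  have uM : `|a - b| <= Num.max `|a - b| `|a - d| by rewrite le_max lexx.
  have vM : `|a - d| <= Num.max `|a - b| `|a - d| by rewrite le_max lexx orbT.
  set M := Num.max _ _ in Me uM vM *.
  set u := `|a - b| in uM *; set v := `|a - d| in vM *.
  have : 0 <= (1 - t) * (M - u) by rewrite mulr_ge0 // subr_ge0.
  have : 0 <= t * (M - v) by rewrite mulr_ge0 // subr_ge0.
  lra.
by move=> [z1 z2] [w1 w2] t01; split; apply: key.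
Qed.

(** The preimage under a chart of a small ball, which is convex: segments in the ball
    join points and give homotopies between paths. *)
Lemma locally_planar_simply_connected :
  locally_planar R S -> locally_simply_connected R S.
Proof.
move=> planS y W Wy; have [c cy] := planS y.
case: c cy => D C m i oD oC [[mDC iCD mK iK] [cm ci]] /= Dy.
have im x : D x -> i (m x) = x by move=> Dx; apply: mK; rewrite inE.
have mi x : C x -> m (i x) = x by move=> Cx; apply: iK; rewrite inE.
have near_i : nbhs (m y) (C `&` i @^-1` W).
  apply: filterI; first by apply: open_nbhs_nbhs; split=> //; exact: mDC.
  have ci' := ci; rewrite continuous_open_subspace // in ci'.
  by apply: ci'; [rewrite inE; exact: mDC|rewrite im].
have [e /= e0 eW] := (nbhs_ballP _ _).1 near_i.
pose V := ball (m y) e; pose A := D `&` m @^-1` V.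
have oA : open A.
  rewrite openE => x [Dx Vx].
  have cm' := cm; rewrite continuous_open_subspace // in cm'.
  apply: filterI; first exact: open_nbhs_nbhs.
  apply: cm'; first by rewrite inE.
  by apply: open_nbhs_nbhs; split=> //; exact: ball_open.
have Ai v : V v -> A (i v).
  by move=> Vv; have [Cv _] := eW v Vv; split; [exact: iCD|rewrite /= mi].
have ci_comp (X : topologicalType) (g : X -> plane) : continuous g ->
    (forall x, V (g x)) -> continuous (i \o g).
  move=> cg Vg; apply: continuous_comp_on ci cg _ => // x.
  by have [] := eW _ (Vg x).
have cseg (X : topologicalType) (a b : X -> plane) (u : X -> R) :
    continuous a -> continuous b -> continuous u ->
    continuous (fun x => segment (a x) (b x) (u x)).
  move=> ca cb cu x.
  have fstc (g : X -> plane) : continuous g -> continuous (fun x => (g x).1).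
    by move=> cg x'; apply: (@continuous_comp _ _ _ g fst); [exact: cg|exact: cvg_fst].
  have sndc (g : X -> plane) : continuous g -> continuous (fun x => (g x).2).
    by move=> cg x'; apply: (@continuous_comp _ _ _ g snd); [exact: cg|exact: cvg_snd].
  have c1 := continuous_interp cu (fstc _ ca) (fstc _ cb).
  have c2 := continuous_interp cu (sndc _ ca) (sndc _ cb).
  exact: (cvg_pair (c1 x) (c2 x)).
exists A; split=> //; first by split=> //; exact: ballxx.
  by move=> x [Dx /eW[_]] /=; rewrite im.
split=> [x z [Dx Vx] [Dz Vz]|x z p q Ap Aq].
  pose g (t : I) := segment (m x) (m z) (ival t).
  have Vg t : V (g t) by apply: ball_segment => //; exact: ival_itv.
  have cg : continuous g.
    by apply: cseg; [exact: cst_continuous..|exact: ival_continuous].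
  have g0 : (i \o g) zero = x.
    rewrite /g /= ival0 /segment subr0 !mul1r !mul0r !addr0.
    by rewrite -surjective_pairing im.
  have g1 : (i \o g) one = z.
    rewrite /g /= ival1 /segment subrr !mul1r !mul0r !add0r.
    by rewrite -surjective_pairing im.
  by exists (mk_path (ci_comp _ _ cg Vg) g0 g1) => t; apply: Ai; exact: Vg.
have cmp (x' z' : S) (r : {path I from x' to z'}) : (forall t, A (r t)) ->
    continuous (m \o r).
  move=> Ar; apply: continuous_comp_on cm _ _ => //; first exact: path_continuous.
  by move=> t; have [] := Ar t.
pose g (w : I * I) := segment (m (p w.1)) (m (q w.1)) (ival w.2).
have Vg w : V (g w).
  by apply: ball_segment; [have [] := Ap w.1|have [] := Aq w.1|exact: ival_itv].
have cg : continuous g.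
  apply: cseg.
  - exact: (continuous_pair_fst (cmp _ _ _ Ap)).
  - exact: (continuous_pair_fst (cmp _ _ _ Aq)).
  - exact/continuous_pair_snd/ival_continuous.
have segE v t : segment v v t = v.
  by rewrite /segment -!mulrDl subrK !mul1r -surjective_pairing.
exists (i \o g); split; [exact: ci_comp|by move=> w; exact: Ai|split=> t].
- rewrite /g /= ival0 /segment subr0 !mul1r !mul0r !addr0.
  by rewrite -surjective_pairing im //; have [] := Ap t.
- rewrite /g /= ival1 /segment subrr !mul1r !mul0r !add0r.
  by rewrite -surjective_pairing im //; have [] := Aq t.
- rewrite /g /= !path_zero segE im //; have [] := Ap zero; rewrite path_zero //.
- rewrite /g /= !path_one segE im //; have [] := Ap one; rewrite path_one //.
Qed.

End LocallyPlanar.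

(** * Classes of arbitrary paths *)

Section PathClass.
Variables (R : realType) (T : topologicalType) (x : T).
Local Notation I := (unit_interval R).

(** Taking the constant path at x makes the class of a loop at x, defined below, its
    usual class. *)
Lemma base_paths : (forall y, joined R setT x y) ->
  exists c : forall y, {path I from x to y}, c x = path_cst R x.
Proof.
move=> jT.
exists (fun y => match pselect (x = y) with
  | left e => match e in _ = y return {path I from x to y} with
              | erefl => path_cst R x end
  | right _ => projT1 (cid (jT y)) end).
by case: pselect => // e; rewrite (Prop_irrelevance e erefl).
Qed.

Variable c : forall y, {path I from x to y}.
Hypothesis cx : c x = path_cst R x.

(** Closing all paths up with a fixed system c of paths from x maps the fundamental
    groupoid to a group: classes of paths with any endpoints can be multiplied. *)
Definition path_class y z (p : {path I from y to z}) : pi1 R x :=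
  loop_class (path_cat (c y) (path_cat p (path_rev (c z)))).

Lemma path_class_homotopic y z (p q : {path I from y to z}) :
  path_homotopic p q -> path_class p = path_class q.
Proof.
move=> pq; apply/loop_classP; apply: homotopic_cat; first exact: homotopic_refl.
by apply: homotopic_cat => //; exact: homotopic_refl.
Qed.

Lemma path_class_cat y z w (p : {path I from y to z}) (q : {path I from z to w}) :
  path_class (path_cat p q) = (path_class p * path_class q)%g.
Proof.
rewrite /path_class loop_class_cat; apply/esym/loop_classP.
apply: homotopic_trans; first by apply: homotopic_sym; exact: homotopic_catA.
apply: homotopic_cat; first exact: homotopic_refl.
apply: homotopic_trans; first by apply: homotopic_sym; exact: homotopic_catA.
apply: (homotopic_trans _ (homotopic_catA _ _ _)).
apply: homotopic_cat; first exact: homotopic_refl.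
apply: (homotopic_trans (homotopic_catA _ _ _)).
apply: homotopic_trans (homotopic_cst_cat _).
by apply: homotopic_cat; [exact: homotopic_rev_cat|exact: homotopic_refl].
Qed.

Lemma path_class_cst y : path_class (path_cst R y) = 1%g.
Proof.
by apply: (mulgI (path_class (path_cst R y))); rewrite mulg1 -path_class_cat;
   apply: path_class_homotopic; exact: homotopic_cst_cat.
Qed.

Lemma path_class_rev y z (p : {path I from y to z}) :
  path_class (path_rev p) = (path_class p)^-1%g.
Proof.
apply/esym/mulg1_eq; rewrite -path_class_cat -(path_class_cst y).
exact/path_class_homotopic/homotopic_cat_rev.
Qed.

Lemma path_class_loop (p : {path I from x to x}) : path_class p = loop_class p.
Proof.
rewrite /path_class cx; apply/loop_classP.
apply: homotopic_trans (homotopic_cst_cat _) _.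
have -> : path_rev (path_cst R x) = path_cst R x by apply/path_eqP.
exact: homotopic_cat_cst.
Qed.

End PathClass.

(** * Finite generation of fundamental groups *)

Section CompactCovers.
Variable T : topologicalType.
Hypotheses (cT : compact [set: T]).

(** Compactness as near covering, along the filter on sets of indices that is
    generated by the sets of all the supersets of a finite set. *)
Lemma compact_finite_cover (V : T -> set T) :
  (forall y : T, nbhs y (V y)) ->
  exists2 D : set T, finite_set D & forall w, exists2 d, D d & V d w.
Proof.
move=> nV.
pose F : set_system (set T) :=
  filter_from finite_set (fun D0 => [set D : set T | D0 `<=` D]).
have FF : Filter F.
  apply: filter_from_filter; first by exists set0; exact: finite_set0.
  move=> D D' finD finD'; exists (D `|` D'); first by rewrite finite_setU.
  by move=> E DE; split=> y ?; apply: DE; [left|right].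
have cov (y : T) : [set: T] y ->
    \forall y' \near y & D \near F, exists2 d, D d & V d y'.
  move=> _; exists (V y, [set D | D y]).
    split=> //=; exists [set y]; first exact: finite_set1.
    by move=> D /= yD; exact: yD.
  by move=> [y' D] [/= Vy' Dy]; exists y.
have [D finD DP] := (compact_near_coveringP [set: T]).1 cT _ F _ FF cov.
by exists D => // w; apply: (DP D).
Qed.

Lemma nbhs_finite_inter (D : set T) (B : T -> set T) (y : T) : finite_set D ->
  (forall d, nbhs y (B d)) -> nbhs y [set w | forall d, D d -> B d w].
Proof.
move=> /finite_seqP[s ->] nB; elim: s => [|d s IH].
  by apply: filterS filterT => w _ d; rewrite /= in_nil.
apply: filterS (filterI (nB d) IH) => w [Bdw Bw] d'; rewrite /= inE.
by move=> /orP[/eqP -> //|ds]; exact: Bw.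
Qed.

(** Regularity gives W d, with closure in A d, around each d, and finitely many W d
    cover. Let N y be contained in A d if y is in the closure of W d, and disjoint
    from this closure otherwise. If N y and N z meet at a point of W d, then both are
    of the first kind for d. *)
Lemma star_refinement (A : T -> set T) : hausdorff_space T ->
  (forall y, open (A y)) -> (forall y, A y y) ->
  exists N : T -> set T, (forall y, nbhs y (N y)) /\
    forall y z w, N y w -> N z w -> exists d, N y `|` N z `<=` A d.
Proof.
move=> hT oA Ay.
have reg y : exists W, nbhs y W /\ closure W `<=` A y.
  have [W nW cW] := compact_regular hT cT filterT (open_nbhs_nbhs (conj (oA y) (Ay y))).
  by exists W.
pose W y := projT1 (cid (reg y)).
have nW y : nbhs y (W y) by rewrite /W; case: cid => ? [].
have cW y : closure (W y) `<=` A y by rewrite /W; case: cid => ? [].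
have [D finD covD] := compact_finite_cover (fun y => nbhs_interior (nW y)).
pose B y d := if `[< closure (W d) y >] then A d else ~` closure (W d).
exists (fun y => [set w | forall d, D d -> B y d w]); split=> [y|y z w yw zw].
  apply: nbhs_finite_inter => // d; rewrite /B; case: asboolP => [clW|nclW].
    by apply: open_nbhs_nbhs; split=> //; exact: cW.
  by apply: open_nbhs_nbhs; split=> //; apply: closed_openC; exact: closed_closure.
have [d Dd Wdw] := covD w; exists d.
have clw : closure (W d) w by apply: subset_closure; exact: interior_subset.
have clB y' : B y' d w -> B y' d `<=` A d.
  by rewrite /B; case: asboolP => [_ _|_ nclw]; [exact: subset_refl|case: (nclw clw)].
by move=> w' [Nw|Nw]; apply: clB (Nw d Dd); [exact: yw|exact: zw].
Qed.

End CompactCovers.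

Section FiniteGeneration.
Variables (R : realType) (T : topologicalType).
Local Notation I := (unit_interval R).
Hypotheses (cT : compact [set: T]) (hT : hausdorff_space T).
Hypotheses (conT : connected [set: T]) (simT : locally_simply_connected R T).

Lemma simply_connected_star_cover : exists V : T -> set T,
  [/\ forall y, open (V y), forall y, V y y, forall y, simply_connected R (V y) &
    forall y z w, V y w -> V z w ->
      exists2 A, simply_connected R A & V y `|` V z `<=` A].
Proof.
have [A AP] : exists A : T -> set T,
    forall y, [/\ open (A y), A y y & simply_connected R (A y)].
  have ex y : exists A : set T, [/\ open A, A y & simply_connected R A].
    by have [A [oA Ay _ sA]] := simT (@filterT _ (nbhs y) _); exists A.
  by exists (fun y => projT1 (cid (ex y))) => y; case: cid.
have [||N [nN starN]] := star_refinement cT hT (A := A).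
- by move=> y; have [] := AP y.
- by move=> y; have [] := AP y.
have ex y : exists V : set T, [/\ open V, V y, V `<=` N y & simply_connected R V].
  exact: simT.
exists (fun y => projT1 (cid (ex y))); split=> [y|y|y|y z w].
- by case: cid => V [].
- by case: cid => V [].
- by case: cid => V [].
case: cid => V [_ _ VN _] /=; case: cid => V' [_ _ VN' _] /= Vw V'w.
have [d NA] := starN y z w (VN _ Vw) (VN' _ V'w).
exists (A d); first by have [] := AP d.
by move=> v [/VN Nv|/VN' Nv]; apply: NA; [left|right].
Qed.

(** Let finitely many simply connected V d cover the space, and let h d y be the class
    of any path in V d from d to y. If y lies in V d and in V e, the class
    h d y (h e y)^-1 is that of a path from d to e in a simply connected set that
    contains V d and V e; it depends on d and e only. These finitely many classes
    generate: cut a loop into paths that lie each in some V d, and compare the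
    consecutive d at the points of division. *)
Theorem pi1_finitely_generated (x : T) : finitely_generated [set: pi1 R x].
Proof.
have [c cx] := base_paths (connected_joined simT conT x).
have [V [oV Vy sV starV]] := simply_connected_star_cover.
have [D finD covD] := compact_finite_cover cT
  (fun y => open_nbhs_nbhs (conj (oV y) (Vy y))).
pose cl y z (p : {path I from y to z}) := path_class c p.
have same A y z (p q : {path I from y to z}) : simply_connected R A ->
    (forall t, A (p t)) -> (forall t, A (q t)) -> cl y z p = cl y z q.
  by move=> sA Ap Aq; apply: path_class_homotopic; exact: simply_connected_homotopic Aq.
pose h y z : pi1 R x := xget 1%g
  [set g | exists2 p : {path I from y to z}, forall t, V y (p t) & g = cl y z p].
have hE y z (p : {path I from y to z}) : (forall t, V y (p t)) ->
    cl y z p = h y z.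
  move=> Vp; rewrite /h; case: xgetP => [g _ [q Vq ->]|/(_ (cl y z p))].
    exact: same Vq.
  by case; exists p.
have hP y z : V y z -> exists2 p : {path I from y to z},
    (forall t, V y (p t)) & h y z = cl y z p.
  by move=> Vz; have [p Vp] := (sV y).1 _ _ (Vy y) Vz; exists p; rewrite ?hE.
pose g y z : pi1 R x := xget 1%g
  [set g | exists w, [/\ V y w, V z w & g = (h y w * (h z w)^-1)%g]].
have gE y z w : V y w -> V z w -> (h y w * (h z w)^-1)%g = g y z.
  move=> Vyw Vzw; rewrite /g; case: xgetP => [_ _ [w' [Vyw' Vzw' ->]]|].
    have [A sA VA] := starV _ _ _ Vyw Vzw.
    have [p Vp ->] := hP _ _ Vyw; have [q Vq ->] := hP _ _ Vzw.
    have [p' Vp' ->] := hP _ _ Vyw'; have [q' Vq' ->] := hP _ _ Vzw'.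
    rewrite /cl -!path_class_rev -!path_class_cat.
    have inA v (r : {path I from y to v}) (s : {path I from z to v}) :
        (forall t, V y (r t)) -> (forall t, V z (s t)) ->
        forall t, A (path_cat r (path_rev s) t).
      move=> Vr Vs t; apply: VA; rewrite /= /mk_path /path_cat_fun.
      by case: ifP => _; [left; exact: Vr|right; exact: Vs].
    by apply: (same A) => //; exact: inA.
  by move=> /(_ (h y w * (h z w)^-1)%g) []; exists w.
have [d0 Dd0 Vd0x] := covD x; pose h0 := h d0 x.
(* Conjugation by h0 brings the classes of paths between centres back to x. *)
pose S := (fun dd : T * T => h0^-1 * g dd.1 dd.2 * h0)%g @` (D `*` D).
exists S; first by apply: finite_image; exact: finite_setX.
rewrite -/(generated S); have sH := generated_subgroup S.
have gS d e : D d -> D e -> generated S (h0^-1 * g d e * h0)%g.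
  by move=> Dd De; apply: sub_generated; exists (d, e).
pose P y z (p : {path I from y to z}) := forall d e, D d -> D e ->
  V d y -> V e z -> generated S (h0^-1 * (h d y * cl y z p * (h e z)^-1) * h0)%g.
have cover (y : T) : exists2 A, [set A | exists2 d, D d & A = V d] A & nbhs y A.
  have [d Dd Vdy] := covD y; exists (V d); first by exists d.
  exact: open_nbhs_nbhs.
have Pall : forall y z (p : {path I from y to z}), P y z p.
  apply: (path_induction cover) =>
      [y z p [_ [k Dk ->] Vp]|y m z p q Pp Pq] d e Dd De Vdy Vez.
    have Vky : V k y by have := Vp zero; rewrite path_zero.
    have Vkz : V k z by have := Vp one; rewrite path_one.
    have [q Vq qE] := hP _ _ Vky.
    have pE : cl y z p = ((h k y)^-1 * h k z)%g.
      apply: (mulgI (h k y)); rewrite mulVKg qE /cl -path_class_cat.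
      apply: hE => t; rewrite /= /mk_path /path_cat_fun.
      by case: ifP => _; [exact: Vq|exact: Vp].
    have -> : (h0^-1 * (h d y * cl y z p * (h e z)^-1) * h0 =
       (h0^-1 * (h d y * (h k y)^-1) * h0) *
       (h0^-1 * (h k z * (h e z)^-1) * h0))%g by rewrite pE !gnorm.
    by rewrite !gE //; apply: (subgroupM sH); exact: gS.
  have [k Dk Vkm] := covD m.
  have -> : (h0^-1 * (h d y * cl y z (path_cat p q) * (h e z)^-1) * h0 =
     (h0^-1 * (h d y * cl y m p * (h k m)^-1) * h0) *
     (h0^-1 * (h k m * cl m z q * (h e z)^-1) * h0))%g.
    by rewrite /cl path_class_cat !gnorm.
  by apply: (subgroupM sH); [exact: Pp|exact: Pq].
apply/seteqP; split=> // a _; have [p ->] := loop_class_surj a.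
have := Pall x x p d0 d0 Dd0 Dd0 Vd0x Vd0x.
by rewrite /cl path_class_loop // -/h0 !gnorm.
Qed.

End FiniteGeneration.

(** * Paths and homotopies in a fiber bundle *)

Section Trivialization.
Variables (R : realType) (F X B : topologicalType) (f : continuousType X B).
Local Notation I := (unit_interval R).

Record trivialization (U : set B) (t : X -> F) (s : B * F -> X) : Prop := {
  triv_open : open U;
  triv_t : {within f @^-1` U, continuous t};
  triv_s : {within U `*` setT, continuous s};
  triv_st : forall x, U (f x) -> s (f x, t x) = x;
  triv_fs : forall b y, U b -> f (s (b, y)) = b;
  triv_ts : forall b y, U b -> t (s (b, y)) = y }.

Lemma local_trivialization : fiber_bundle F f -> locally_simply_connected R B ->
  forall b, exists U t s, [/\ trivialization U t s, U b & simply_connected R U].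
Proof.
move=> bund simB b.
have [U' [oU' U'b [t [s [[to_ from_ st ts] [ct cs]]]]]] := bund b.
have [U [oU Ub UU' sU]] := simB b U' (open_nbhs_nbhs (conj oU' U'b)).
have ts' b' y : U b' -> (f (s (b', y)), t (s (b', y))) = (b', y).
  by move=> /UU' Ub'; apply: (ts (b', y)); rewrite inE.
exists U, t, s; split=> //; split=> //.
- have UX : f @^-1` U `<=` f @^-1` U' by move=> x; exact: UU'.
  have oA : open (f @^-1` U) by apply: open_comp => // x _; exact: cts_fun.
  have := continuous_subspaceW UX ct.
  rewrite !continuous_open_subspace // => cg x Ux.
  apply: (@continuous_comp _ _ _ (fun x => (f x, t x)) snd); first exact: cg.
  exact: cvg_snd.
- by apply: continuous_subspaceW cs => -[b' y] [/= Ub' _]; split=> //; exact: UU'.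
- by move=> x /UU' Ux; apply: (st x); rewrite inE.
- by move=> b' y /(ts' _ y) [].
- by move=> b' y /(ts' _ y) [].
Qed.

Variables (U : set B) (t : X -> F) (s : B * F -> X).
Hypothesis triv : trivialization U t s.

Let openU : open U := triv_open triv.

Let open_total : open (f @^-1` U).
Proof. by apply: open_comp => // x _; exact: cts_fun. Qed.

Lemma fiber_coordinate a c (p : {path I from a to c}) :
  (forall z, U (f (p z))) ->
  exists q : {path I from t a to t c}, forall z, q z = t (p z).
Proof.
move=> Up.
have cq : continuous (t \o p).
  by apply: continuous_comp_on (triv_t triv) _ Up => //; exact: path_continuous.
have q0 : (t \o p) zero = t a by rewrite /= path_zero.
have q1 : (t \o p) one = t c by rewrite /= path_one.
by exists (mk_path cq q0 q1).
Qed.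

Lemma continuous_section (S : topologicalType) (g : S -> B) (h : S -> F) :
  continuous g -> continuous h -> (forall z, U (g z)) ->
  continuous (fun z => s (g z, h z)).
Proof.
move=> cg ch Ug.
have oUT : open (U `*` [set: F]).
  have -> : U `*` [set: F] = fst @^-1` U by apply/seteqP; split=> z // [].
  by apply: open_comp => // z' _; exact: cvg_fst.
apply: (continuous_comp_on oUT (triv_s triv)) => [z|z]; last by split; [exact: Ug|].
exact: (cvg_pair (cg z) (ch z)).
Qed.

Lemma path_of_coordinates a c (b : {path I from f a to f c})
    (q : {path I from t a to t c}) : (forall z, U (b z)) ->
  exists p : {path I from a to c}, forall z, p z = s (b z, q z).
Proof.
move=> Ub.
have cp : continuous (fun z : I => s (b z, q z)).
  by apply: continuous_section => //; exact: path_continuous.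
have p0 : s (b zero, q zero) = a.
  by have := Ub zero; rewrite !path_zero => /(triv_st triv).
have p1 : s (b one, q one) = c.
  by have := Ub one; rewrite !path_one => /(triv_st triv).
by exists (mk_path cp p0 p1).
Qed.

(** The coordinates in the base of the two paths are homotopic in U, because U is
    simply connected; the trivialization lifts the pair of homotopies. *)
Lemma homotopic_of_coordinates a c (p p' : {path I from a to c})
    (q q' : {path I from t a to t c}) : simply_connected R U ->
  (forall z, U (f (p z))) -> (forall z, U (f (p' z))) ->
  (forall z, q z = t (p z)) -> (forall z, q' z = t (p' z)) ->
  path_homotopic q q' -> path_homotopic p p'.
Proof.
move=> [_ sU] Up Up' qE q'E [K [cK [K0 K1 Ka Kc]]].
have [H [cH UH [H0 H1 Ha Hc]]] := sU _ _
  (f \o p : {path I from f a to f c}) (f \o p' : {path I from f a to f c}) Up Up'.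
exists (fun z => s (H z, K z)); split; first exact: continuous_section.
have Ua : U (f a) by rewrite -(path_start p); exact: Up.
have Uc : U (f c) by rewrite -(path_end p); exact: Up.
split=> z; rewrite ?H0 ?H1 ?Ha ?Hc ?K0 ?K1 ?Ka ?Kc ?qE ?q'E /=;
  exact: (triv_st triv).
Qed.

End Trivialization.

Section Bundle.
Variables (R : realType) (F X B : topologicalType) (f : continuousType X B).
Local Notation I := (unit_interval R).
Hypotheses (bund : fiber_bundle F f) (simB : locally_simply_connected R B).
Hypothesis joinF : forall y z : F, joined R setT y z.

Definition in_fiber a c (v : {path I from a to c in X}) : Prop :=
  forall z, f (v z) = f a.

Definition trivial_open : set (set B) :=
  [set U | simply_connected R U /\ exists (t : X -> F) s, trivialization f U t s].

Lemma trivial_cover (b : B) : exists2 U, trivial_open U & nbhs b U.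
Proof.
have [U [t [s [triv Ub sU]]]] := local_trivialization bund simB b.
exists U; first by split=> //; exists t, s.
by apply: open_nbhs_nbhs; split=> //; exact: triv_open triv.
Qed.

Lemma fiber_joined a c : f a = f c ->
  exists v : {path I from a to c in X}, in_fiber v.
Proof.
move=> fac; have [U [t [s [triv Ua _]]]] := local_trivialization bund simB (f a).
have [q _] := joinF (t a) (t c).
have b0 : cst (f a) (zero : I) = f a by [].
have b1 : cst (f a) (one : I) = f c by [].
pose b := mk_path (@cst_continuous I B (f a)) b0 b1.
have [p pE] := path_of_coordinates triv (b := b) q (fun=> Ua).
by exists p => z; rewrite pE (triv_fs triv).
Qed.

(** Over a trivializing set, keep the coordinate in the fiber constant. *)
Lemma path_lifting b b' (g : {path I from b to b' in B}) a : f a = b ->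
  exists c (p : {path I from a to c in X}), forall z, f (p z) = g z.
Proof.
move: b b' g a; apply: (path_induction trivial_cover) => [b b' g|b m b' g h IHg IHh].
  move=> [U [_ [t [s triv]]] Ug] a fa.
  have Ub : U b by rewrite -(path_start g).
  have Ub' : U b' by rewrite -(path_end g).
  have cp : continuous (fun z : I => s (g z, t a)).
    apply: (continuous_section triv) => //; first exact: path_continuous.
    exact: cst_continuous.
  have p0 : s (g zero, t a) = a.
    by rewrite path_zero -fa (triv_st triv) // fa.
  have p1 : s (g one, t a) = s (b', t a) by rewrite path_one.
  by exists (s (b', t a)), (mk_path cp p0 p1) => z; rewrite /mk_path /= (triv_fs triv).
move=> a fa; have [c [p pE]] := IHg a fa.
have fc : f c = m by rewrite -(path_end p) pE path_one.
have [d [q qE]] := IHh c fc.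
exists d, (path_cat p q) => z; rewrite /= /mk_path /path_cat_fun.
by case: ifP.
Qed.

Hypothesis joinB : forall b b' : B, joined R setT b b'.

Lemma total_joined a c : joined R [set: X] a c.
Proof.
have [g _] := joinB (f a) (f c); have [d [p pE]] := path_lifting g (erefl (f a)).
have fd : f d = f c by rewrite -(path_end p) pE path_one.
have [v _] := fiber_joined fd.
by exists (path_cat p v).
Qed.

Variables (x : X) (base : forall y, {path I from x to y in X}).
Local Notation cl := (path_class base).
Local Open Scope group_scope.

Lemma in_fiber_rev a c (v : {path I from a to c in X}) :
  in_fiber v -> in_fiber (path_rev v).
Proof.
move=> vv z; rewrite /= /mk_path /path_rev_fun vv -(path_end v); exact/esym/vv.
Qed.

(** Homotopy lifting for H up to paths in fibers: p and r lift the lower and right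
    sides of H, and l and q its left and upper sides. The paths h and w in fibers, at
    two corners, make lifts composable that need not have common endpoints. The
    quantification over all lifts and over u lets small squares be pasted along
    arbitrary lifts of their common sides. *)
Definition square_commutes (H : I * I -> B) : Prop :=
  forall a b b1 c a' d d1 c1
    (p : {path I from a to b in X}) (h : {path I from b to b1 in X})
    (r : {path I from b1 to c in X}) (u : {path I from a to a' in X})
    (l : {path I from a' to d in X}) (w : {path I from d to d1 in X})
    (q : {path I from d1 to c1 in X}),
  (forall z, f (p z) = H (z, zero)) -> (forall z, f (r z) = H (one, z)) ->
  (forall z, f (l z) = H (zero, z)) -> (forall z, f (q z) = H (z, one)) ->
  in_fiber h -> in_fiber u -> in_fiber w ->
  exists2 v : {path I from c to c1 in X}, in_fiber v &
    cl p * cl h * cl r * cl v = cl u * cl l * cl w * cl q.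

Lemma half_ends : [/\ @lower_half R zero = zero, @upper_half R one = one
  & @upper_half R zero = lower_half one].
Proof.
by split; apply: ival_inj; rewrite ?ival_lower_half ?ival_upper_half ?ival0 ?ival1;
  lra.
Qed.

(** Over a trivializing simply connected set, v is found in the fiber coordinate, which
    it corrects; the base coordinates agree up to homotopy for free. Two halves of a
    square are pasted along a lift m of their common side: the path v in a fiber that
    the first half yields is the correcting path of the second. *)
Lemma square_commutes_all H : continuous H -> square_commutes H.
Proof.
have [low0 up1 up0] := half_ends.
apply: (square_induction trivial_cover) => {}H cH.
- move=> [U [sU [t [s triv]]] UH] a b b1 c a' d d1 c1 p h r u l w q
    pE rE lE qE hE uE wE.
  have Up z : U (f (p z)) by rewrite pE.
  have Ur z : U (f (r z)) by rewrite rE.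
  have Ul z : U (f (l z)) by rewrite lE.
  have Uq z : U (f (q z)) by rewrite qE.
  have Uh z : U (f (h z)) by rewrite hE -(path_end p).
  have Uu z : U (f (u z)) by rewrite uE -(path_start p).
  have Uw z : U (f (w z)) by rewrite wE -(path_end l).
  have Ucat a1 a2 a3 (p1 : {path I from a1 to a2 in X})
      (p2 : {path I from a2 to a3 in X}) : (forall z, U (f (p1 z))) ->
      (forall z, U (f (p2 z))) -> forall z, U (f (path_cat p1 p2 z)).
    by move=> U1 U2 z; rewrite /= /mk_path /path_cat_fun; case: ifP.
  pose P := path_cat (path_cat p h) r.
  pose Q := path_cat (path_cat (path_cat u l) w) q.
  have UP := Ucat _ _ _ _ _ (Ucat _ _ _ _ _ Up Uh) Ur.
  have UQ := Ucat _ _ _ _ _ (Ucat _ _ _ _ _ (Ucat _ _ _ _ _ Uu Ul) Uw) Uq.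
  have [tP tPE] := fiber_coordinate triv UP.
  have [tQ tQE] := fiber_coordinate triv UQ.
  have Uc : U (f c) by rewrite -(path_end r).
  have fc : f c = f c1 by rewrite -(path_end r) -(path_end q) rE qE.
  have b_0 : cst (f c) (zero : I) = f c by [].
  have b_1 : cst (f c) (one : I) = f c1 by [].
  pose bc := mk_path (@cst_continuous I B (f c)) b_0 b_1.
  have [v vE] := path_of_coordinates triv (b := bc)
    (path_cat (path_rev tP) tQ) (fun=> Uc).
  have vv : in_fiber v by move=> z; rewrite vE (triv_fs triv).
  exists v => //.
  have -> : cl u * cl l * cl w * cl q = cl Q by rewrite /Q !path_class_cat.
  have -> : cl p * cl h * cl r * cl v = cl (path_cat P v).
    by rewrite /P !path_class_cat.
  apply: path_class_homotopic.
  have Uv z : U (f (v z)) by rewrite vv.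
  apply: (homotopic_of_coordinates triv
    (q := path_cat tP (path_cat (path_rev tP) tQ)) (q' := tQ)) => //.
  + exact: Ucat.
  + move=> z; rewrite /= /mk_path /path_cat_fun; case: ifP => _; first exact: tPE.
    by rewrite vE (triv_ts triv).
  + apply: homotopic_trans; first exact: homotopic_catA.
    apply: homotopic_trans (homotopic_cst_cat _).
    by apply: homotopic_cat; [exact: homotopic_cat_rev|exact: homotopic_refl].
- move=> IHl IHu a b b1 c a' d d1 c1 p h r u l w q pE rE lE qE hE uE wE.
  have [e [p1 [p2 [pcat p1E p2E]]]] := split_path p.
  have [e' [q1 [q2 [qcat q1E q2E]]]] := split_path q.
  have cg : continuous (fun z => H (lower_half one, z)).
    by apply: continuous_comp2 => //; [exact: cst_continuous|exact: idI_continuous].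
  have fe : f e = H (lower_half one, zero) by rewrite -(path_end p1) p1E pE.
  have [e2 [m mE]] := path_lifting (mk_path cg erefl erefl) fe.
  have [|||||||v vv Ev] :=
    IHl _ _ _ _ _ _ _ _ p1 (path_cst R e) m u l w q1 => //.
  - by move=> z; rewrite p1E pE.
  - by move=> z; rewrite lE low0.
  - by move=> z; rewrite q1E qE.
  have [|||||||v' vv' Ev'] :=
    IHu _ _ _ _ _ _ _ _ p2 h r (path_cst R e) m v q2 => //.
  - by move=> z; rewrite p2E pE.
  - by move=> z; rewrite rE up1.
  - by move=> z; rewrite mE up0.
  - by move=> z; rewrite q2E qE.
  exists v' => //; rewrite pcat qcat !path_class_cat.
  rewrite path_class_cst mulg1 in Ev; rewrite path_class_cst mul1g in Ev'.
  have -> : cl p1 * cl p2 * cl h * cl r * cl v' =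
     cl p1 * (cl p2 * cl h * cl r * cl v') by rewrite !mulgA.
  by rewrite Ev' !mulgA Ev.
- move=> IHl IHu a b b1 c a' d d1 c1 p h r u l w q pE rE lE qE hE uE wE.
  have [e [r1 [r2 [rcat r1E r2E]]]] := split_path r.
  have [e' [l1 [l2 [lcat l1E l2E]]]] := split_path l.
  have cg : continuous (fun z => H (z, lower_half one)).
    by apply: continuous_comp2 => //; [exact: idI_continuous|exact: cst_continuous].
  have fe : f e' = H (zero, lower_half one) by rewrite -(path_end l1) l1E lE.
  have [e2 [m mE]] := path_lifting (mk_path cg erefl erefl) fe.
  have [|||||||v vv Ev] :=
    IHl _ _ _ _ _ _ _ _ p h r1 u l1 (path_cst R e') m => //.
  - by move=> z; rewrite pE low0.
  - by move=> z; rewrite r1E rE.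
  - by move=> z; rewrite l1E lE.
  have [|||||||v' vv' Ev'] :=
    IHu _ _ _ _ _ _ _ _ m (path_rev v) r2 (path_cst R e') l2 w q => //.
  - by move=> z; rewrite mE up0.
  - by move=> z; rewrite r2E rE.
  - by move=> z; rewrite l2E lE.
  - by move=> z; rewrite qE up1.
  - exact: in_fiber_rev.
  exists v' => //; rewrite rcat lcat !path_class_cat.
  rewrite path_class_cst mulg1 in Ev.
  rewrite path_class_cst mul1g path_class_rev in Ev'.
  have -> : cl u * (cl l1 * cl l2) * cl w * cl q =
     cl u * cl l1 * (cl l2 * cl w * cl q) by rewrite !mulgA.
  by rewrite -Ev' !mulgA -Ev !gnorm.
Qed.

(** The square of a null homotopy has three constant sides, lifted by constant
    paths. *)
Lemma null_homotopic_in_fiber (p : {path I from x to x in X}) :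
  path_homotopic (f \o p : {path I from f x to f x}) (path_cst R (f x)) ->
  base x = path_cst R x ->
  exists2 v : {path I from x to x in X}, in_fiber v &
    loop_class p = loop_class v.
Proof.
move=> [H [cH [H0 H1 Hx Hy]]] bx.
pose k := path_cst R x.
have [|||||||v vv] :=
  (square_commutes_all cH : square_commutes H) _ _ _ _ _ _ _ _ p k k k k k k => //.
- by move=> z; rewrite H0.
rewrite !path_class_cst !mulg1 => pv1.
exists (path_rev v); first exact: in_fiber_rev.
rewrite -!(path_class_loop bx) path_class_rev; apply/eqP.
by rewrite -mulg_eq1 pv1.
Qed.

End Bundle.

(** * The exact sequence of a bundle and its first cohomology *)

Section FiniteGenerationTransfer.
Variables (G L : groupType) (h : G -> L).
Hypothesis hM : {morph h : a b / (a * b)%g}.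

Lemma morph1 : h 1%g = 1%g.
Proof. by apply: (mulgI (h 1%g)); rewrite -hM !mulg1. Qed.

Lemma morphV a : h (a^-1)%g = ((h a)^-1)%g.
Proof. by apply/esym/mulg1_eq; rewrite -hM mulgV morph1. Qed.

Lemma finitely_generated_image :
  finitely_generated [set: G] -> finitely_generated (range h).
Proof.
move=> [S finS genS]; exists (h @` S); first exact: finite_image.
have sg := generated_subgroup (h @` S).
apply/seteqP; split=> [_ [a _ <-]|].
  suff : [set: G] `<=` h @^-1` generated (h @` S) by apply.
  rewrite genS; apply: generated_sub => [|b Sb].
    split=> [|b c Sb Sc] /=; first by rewrite morph1; exact: subgroup1.
    by rewrite hM morphV; exact: sg.2.
  by apply: sub_generated; exists b.
apply: generated_sub => [|_ [a _ <-]]; last by exists a.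
split; first by exists 1%g => //; exact: morph1.
by move=> _ _ [a _ <-] [b _ <-]; exists (a * b^-1)%g; rewrite ?hM ?morphV.
Qed.

Lemma finitely_generated_extension : (forall b, exists a, h a = b) ->
  finitely_generated [set a | h a = 1%g] -> finitely_generated [set: L] ->
  finitely_generated [set: G].
Proof.
move=> hsurj [S finS kerS] [S' finS' genS'].
pose r b := projT1 (cid (hsurj b)).
have hr b : h (r b) = b by rewrite /r; case: cid.
exists (S `|` r @` S'); first by rewrite finite_setU; split=> //; exact: finite_image.
rewrite -/(generated _); have sg := generated_subgroup (S `|` r @` S').
apply/seteqP; split=> // a _.
have [c Gc hc] : exists2 c, generated (S `|` r @` S') c & h c = h a.
  suff : [set: L] `<=` h @` generated (S `|` r @` S') by apply.
  rewrite genS'; apply: generated_sub => [|b S'b].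
    split; first by exists 1%g; [exact: subgroup1|exact: morph1].
    move=> _ _ [b Sb <-] [c Sc <-]; exists (b * c^-1)%g; first exact: sg.2.
    by rewrite hM morphV.
  by exists (r b) => //; apply: sub_generated; right; exists b.
rewrite -(mulgVK c a); apply: (subgroupM sg) => //.
apply: (@subset_generated _ S) => [b Sb|]; first by left.
rewrite /generated -kerS /= hM morphV hc mulgV //.
Qed.

End FiniteGenerationTransfer.

Section BundleGroups.
Variables (R : realType) (F X B : topologicalType) (f : continuousType X B).
Local Notation I := (unit_interval R).
Hypotheses (bund : fiber_bundle F f) (simB : locally_simply_connected R B).
Hypothesis joinF : forall y z : F, joined R setT y z.
Hypothesis joinB : forall b b' : B, joined R setT b b'.

Lemma pi1_map_surjective (x : X) (a : pi1 R (f x)) :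
  exists g, pi1_map f g = a.
Proof.
have [q ->] := loop_class_surj a.
have [c [p pE]] := path_lifting bund simB q (erefl (f x)).
have fc : f c = f x by rewrite -(path_end p) pE path_one.
have [v vv] := fiber_joined bund simB joinF fc.
exists (loop_class (path_cat p v)); rewrite pi1_mapE; apply/loop_classP.
apply: homotopic_trans (homotopic_cat_cst q).
suff -> : (f \o path_cat p v : {path I from f x to f x}) =
    path_cat q (path_cst R (f x)) by exact: homotopic_refl.
apply/path_eqP => t; rewrite /= /mk_path /path_cat_fun; case: ifP => _.
  by rewrite pE.
by rewrite vv fc.
Qed.

(** Exactness of the homotopy sequence at the group of X. *)
Lemma pi1_kernel_fiber (i : continuousType F X) (y : F) :
  (forall z, f (i z) = f (i y)) ->
  (forall v : {path I from i y to i y in X}, in_fiber f v ->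
    exists q : {path I from y to y in F}, forall z, i (q z) = v z) ->
  [set g : pi1 R (i y) | pi1_map f g = 1%g] = range (@pi1_map R F X i y).
Proof.
move=> fi lift; have [base bx] := base_paths (total_joined bund simB joinF joinB (i y)).
apply/seteqP; split=> g /=.
  have [p ->] := loop_class_surj g; rewrite pi1_mapE => /loop_classP p1.
  have [v vv ->] := null_homotopic_in_fiber bund simB p1 bx.
  have [q qE] := lift v vv; exists (loop_class q) => //.
  rewrite pi1_mapE; congr loop_class; apply/path_eqP; exact: qE.
move=> [a _ <-]; have [q ->] := loop_class_surj a; rewrite !pi1_mapE.
suff -> : (f \o (i \o q : {path I from i y to i y}) : {path I from f (i y) to f (i y)}) =
  path_cst R (f (i y)) by [].
by apply/path_eqP => z /=; exact: fi.
Qed.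

Lemma pi1_kernel_finitely_generated (x : X) :
  (forall y : F, finitely_generated [set: pi1 R y]) ->
  finitely_generated [set g : pi1 R x | pi1_map f g = 1%g].
Proof.
move=> fgF; have [U [t [s [triv Ux _]]]] := local_trivialization bund simB (f x).
have ci : continuous (fun y => s (f x, y)).
  apply: (continuous_section triv) => // [|y]; first exact: cst_continuous.
  exact: cvg_id.
pose i : continuousType F X := HB.pack (fun y => s (f x, y))
  (isContinuous.Build _ _ _ ci).
have iE : i (t x) = x by exact: (triv_st triv).
have fi z : f (i z) = f (i (t x)) by rewrite iE; exact: (triv_fs triv).
have lift (v : {path I from i (t x) to i (t x) in X}) : in_fiber f v ->
    exists q : {path I from t x to t x in F}, forall z, i (q z) = v z.
  move=> vv.
  have Uv z : U (f (v z)) by rewrite vv iE.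
  have [q qE] := fiber_coordinate triv Uv.
  have q0 : q zero = t x by rewrite path_zero iE.
  have q1 : q one = t x by rewrite path_one iE.
  exists (mk_path (path_continuous (p := q)) q0 q1) => z.
  have <- : s (f (v z), t (v z)) = v z by exact: (triv_st triv).
  have -> : f (v z) = f x by rewrite vv iE.
  by rewrite -qE.
have transport z z' : z = z' ->
    finitely_generated [set g : pi1 R z | pi1_map f g = 1%g] ->
    finitely_generated [set g : pi1 R z' | pi1_map f g = 1%g] by move=> ->.
apply: (transport _ _ iE); rewrite (pi1_kernel_fiber fi lift).
by apply: finitely_generated_image; [exact: pi1_map_mul|exact: fgF].
Qed.

End BundleGroups.

Section Cohomology.
Variables (R : realType).

Lemma H1_morph (G : groupType) (phi : H1 R G) :
  {morph phi : a b / (a * b)%g >-> a + b}.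
Proof. by case: phi => phi /= /asboolP. Qed.

(** Otherwise the first cohomology would be zero, while it has dimension 2 g. *)
Lemma nonzero_class_of_genus (T : topologicalType) g (y : T) :
  has_genus R T g -> (0 < g)%N -> exists (phi : H1 R (pi1 R y)) a, phi a != 0.
Proof.
move=> /(_ y) [u ubij] g0.
have n0 : (0 < g.*2)%N by rewrite double_gt0.
apply: contrapT => nex.
have H1_0 (phi : H1 R (pi1 R y)) : phi = 0.
  apply/val_inj/funext => a /=; apply/eqP/negPn/negP => phia.
  by apply: nex; exists phi, a.
have [v _ vK] := ubij.
pose w : 'rV[R]_g.*2 := const_mx 1.
have : w = 0 by rewrite -(vK w) (H1_0 (v w)) linear0.
move=> /rowP/(_ (Ordinal n0)); rewrite !mxE => /eqP.
by rewrite oner_eq0.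
Qed.

(** A character that vanishes on the kernel of h factors through h. *)
Lemma pullback_bijective (G L : groupType) (h : {multiplicative G -> L}) :
  (forall b, exists a, h a = b) ->
  (forall (phi : H1 R G) a, h a = 1%g -> phi a = 0) ->
  bijective (H1_pullback (R := R) h).
Proof.
move=> hsurj hker.
have hM : {morph h : a b / (a * b)%g} by exact: gmulfM.
pose r b := projT1 (cid (hsurj b)).
have hr b : h (r b) = b by rewrite /r; case: cid.
have hE (phi : H1 R G) a a' : h a = h a' -> phi a = phi a'.
  move=> haa'; have : phi (a * a'^-1)%g = 0.
    by apply: hker; rewrite hM (morphV hM) haa' mulgV.
  rewrite (H1_morph phi) (characterV (H1_morph phi)) => /eqP.
  by rewrite subr_eq0 => /eqP.
have psiP (phi : H1 R G) : (phi \o r : L -> R^o) \in @is_cocycle R L.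
  apply/asboolP => b c /=; rewrite -(H1_morph phi); apply: hE.
  by rewrite hM !hr.
exists (fun phi => MkH1 (psiP phi)) => phi; apply/val_inj/funext => b /=.
  by rewrite hr.
by apply: hE; rewrite hr.
Qed.

End Cohomology.

Lemma surface_locally_simply_connected (R : realType) (S : topologicalType) :
  surface R S -> locally_simply_connected R S.
Proof. by move=> [_ _ _ [_ planS _]]; exact: locally_planar_simply_connected. Qed.

Lemma surface_joined (R : realType) (S : topologicalType) :
  surface R S -> forall y z : S, joined R setT y z.
Proof.
move=> surS; have [_ _ conS _] := surS.
exact: connected_joined (surface_locally_simply_connected surS) conS.
Qed.

Lemma surface_pi1_finitely_generated (R : realType) (S : topologicalType) :
  surface R S -> forall y : S, finitely_generated [set: pi1 R y].
Proof.
move=> surS y; have [_ cS conS [hS _ _]] := surS.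
exact: pi1_finitely_generated cS hS conS (surface_locally_simply_connected surS) y.
Qed.

Local Close Scope ring_scope.
Local Close Scope classical_set_scope.

Theorem corollary2 (R : realType) (F X B : topologicalType)
    (f : continuousType X B) (gF gB : nat) (x : X) :
  surface R F -> surface R B ->
  has_genus R F gF -> has_genus R B gB -> (0 < gF)%N -> (0 < gB)%N ->
  fiber_bundle F f ->
  albanese_dim R f x = 2 ->
  algebraically_fibers (pi1 R x).
Proof.
move=> surF surB _ genB _ gB0 bund alb2.
have simB := surface_locally_simply_connected surB.
have joinF := surface_joined surF; have joinB := surface_joined surB.
have fsurj := pi1_map_surjective bund simB joinF (x := x).
pose h := @pi1_map R X B f x.
have hM : {morph h : a b / (a * b)%g} by exact: pi1_map_mul.
pose K := [set g | h g = 1%g]%classic.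
have fgK : finitely_generated K.
  apply: (pi1_kernel_finitely_generated bund simB joinF joinB).
  exact: surface_pi1_finitely_generated.
have fgG : finitely_generated [set: pi1 R x]%classic.
  apply: (finitely_generated_extension hM fsurj fgK).
  exact: surface_pi1_finitely_generated.
have [phi [k [hk phik]]] : exists (phi : H1 R (pi1 R x)) k,
    K k /\ phi k != 0%R.
  apply: contrapT => nex; move: alb2; rewrite /albanese_dim asboolT //.
  apply: pullback_bijective => [|phi g hg]; first exact: fsurj.
  by apply: contrapT => /eqP phig; apply: nex; exists phi, g.
have [psi [psiM psik _]] := integral_character fgG (H1_morph phi) phik.
have [beta [b betab]] := nonzero_class_of_genus (f x) genB gB0.
have [a ha] := fsurj b.
have betahM : {morph beta \o h : a b / (a * b)%g >-> (a + b)%R}.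
  by move=> c d /=; rewrite hM (H1_morph beta).
have betaha : (beta \o h) a != 0%R by rewrite /= /h ha.
have [alpha [alphaM alphaa alphaK]] := integral_character fgG betahM betaha.
apply: (@fibers_of_two_characters _ K psi alpha) => //.
- move=> c g Kc; rewrite /K /= !hM (morphV hM) (_ : h c = 1%g) //.
  by rewrite mulg1 mulgV.
- by exists k.
- move=> c Kc; apply: alphaK; rewrite /= (_ : h c = 1%g) //.
  exact: (character1 (H1_morph beta)).
- by exists a.
Qed.
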